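(* Every Rota-Baxter Lie algebra $(\mathfrak g,R)$ of weight $1$ over $\mathbf k$ has a universal Rota-Baxter $p$-envelope, namely $(\mathfrak g^{(p)},(-)^p,R,i)$, where $\mathfrak g^{(p)}=\mathrm{span}_{\mathbf k}\{x^{p^k}\in\mathrm U(\mathfrak g)\mid x\in\mathfrak g,\ k\ge0\}$ is the Lie algebra of primitive elements of $\mathrm U(\mathfrak g)$ (commutator bracket), $(-)^p$ is the $p$-th power in $\mathrm U(\mathfrak g)$, $R$ on $\mathfrak g^{(p)}$ is the restriction of the extension of $R$ to $\mathrm U(\mathfrak g)$, and $i:\mathfrak g\to\mathfrak g^{(p)}$ is the natural embedding.
   Context: Convention: $\mathbf k$ is an algebraically closed field of prime characteristic $p$; everything is over $\mathbf k$. Rota-Baxter Lie algebra of weight $\lambda$: a Lie algebra with a linear map $R$ such that $[R(x),R(y)]=R([R(x),y])+R([x,R(y)])+\lambda R([x,y])$ for all $x,y$. Extension to $\mathrm U(\mathfrak g)$ (Goncharov): a Rota-Baxter operator $R$ of weight $1$ on $\mathfrak g$ extends to a well-defined linear map $R:\mathrm U(\mathfrak g)\to\mathrm U(\mathfrak g)$ determined by $R(1)=1$ and $R(xy)=R(x)R(y)-R([R(x),y])$ for $x\in\mathfrak g$, $y\in\mathrm U(\mathfrak g)$ (commutator in $\mathrm U(\mathfrak g)$). It is a coalgebra endomorphism (elements of $\mathfrak g$ primitive) satisfying $R(x)R(y)=R(x_1R(x_2)\,y\,S(R(x_3)))$ for all $x,y\in\mathrm U(\mathfrak g)$ (Sweedler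 notation, $S$ the antipode). Restricted Lie algebra: a Lie algebra $(\mathfrak g,[-,-])$ with a $p$-map $(-)^{[p]}:\mathfrak g\to\mathfrak g$ satisfying $(ax)^{[p]}=a^px^{[p]}$ for $a\in\mathbf k$, $[x^{[p]},y]=(\mathrm{ad}_x)^p(y)$, and $(x+y)^{[p]}=x^{[p]}+y^{[p]}+\sum_{i=1}^{p-1}s_i(x,y)$, where $i\,s_i(x,y)$ is the coefficient of $t^{i-1}$ in $(\mathrm{ad}_{tx+y})^{p-1}(x)\in\mathbf k[t]\otimes\mathfrak g$. For a composition $\alpha=(\alpha_1,\dots,\alpha_r)\vDash n$ (a tuple of positive integers with sum $n$, of length $\ell(\alpha)=r$), $C_\alpha=\prod_{k=1}^r\binom{\alpha_1+\cdots+\alpha_k-1}{\alpha_k-1}$. A restricted Rota-Baxter Lie algebra $(\mathfrak g,[-,-],(-)^{[p]},R)$ of weight $\lambda$ is a restricted Lie algebra with a Rota-Baxter operator $R$ of weight $\lambda$ such that $R(x^{[p]_R})=R(x)^{[p]}$ for all $x\in\mathfrak g$, where, with $x\rhd_Ry:=[R(x),y]$ and $x^{\rhd_Rk}:=x\rhd_R(x\rhd_R\cdots(x\rhd_Rx)\cdots)$ ($k$ copies of $x$, $x^{\rhd_R1}=x$), $$x^{[p]_R}:=\lambda^{p-1}x^{[p]}+\sum_{r=1}^{p-1}\frac1r\lambda^{r-1}\sum_{\alpha\vDash p,\ \ell(\alpha)=r}C_\alpha\,[x^{\rhd_R\alpha_1},[x^{\rhd_R\alpha_2},[\cdots[x^{\rhd_R\alpha_{r-1}},x^{\rhd_R\alpha_r}]\cdots]]]$$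 ($\frac1r$ is the inverse of $r$ modulo $p$). Homomorphisms of (restricted) Rota-Baxter Lie algebras are Lie algebra homomorphisms commuting with the Rota-Baxter operators (and the $p$-maps). A Rota-Baxter $p$-subalgebra of a restricted Rota-Baxter Lie algebra is a Lie subalgebra stable under $R$ and closed under the $p$-map; for a subset $E$, $E_p$ is the intersection of all Rota-Baxter $p$-subalgebras containing $E$. A Rota-Baxter $p$-envelope of a Rota-Baxter Lie algebra $(\mathfrak g,R)$ is a tuple $(\mathfrak l,(-)^{[p]'},R',i)$ with $(\mathfrak l,(-)^{[p]'},R')$ a restricted Rota-Baxter Lie algebra (of the same weight) and $i:\mathfrak g\to\mathfrak l$ an injective Rota-Baxter Lie algebra homomorphism with $i(\mathfrak g)_p=\mathfrak l$. It is universal if for every restricted Rota-Baxter Lie algebra $\mathfrak c$ (of the same weight) and Rota-Baxter Lie algebra homomorphism $f:\mathfrak g\to\mathfrak c$ there is a unique restricted Rota-Baxter Lie algebra homomorphism $g:\mathfrak l\to\mathfrak c$ with $g\circ i=f$. *)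

(* Defs.v *)
From HB Require Import structures.
From mathcomp Require Import all_boot all_order all_algebra.
From mathcomp Require Import boolp classical_sets.

Set Implicit Arguments.
Unset Strict Implicit.
Unset Printing Implicit Defensive.

Import GRing.Theory.
Local Open Scope ring_scope.
Local Open Scope quotient_scope.
Local Open Scope classical_set_scope.

Section Terms.
Variables (k : fieldType) (X : Type).

Inductive term :=
  | TGen of X
  | TScal of k
  | TAdd of term & term
  | TMul of term & term.

Definition topp t := TMul (TScal (-1)) t.

Fixpoint teval (A : algType k) (f : X -> A) (t : term) : A :=
  match t with
  | TGen x => f x
  | TScal a => a%:A
  | TAdd t u => teval f t + teval f u
  | TMul t u => teval f t * teval f u
  end.

HB.instance Definition _ := gen_eqMixin term.
HB.instance Definition _ := gen_choiceMixin term.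

End Terms.
Arguments TScal {k X} _.
Arguments TGen {k X} _.

(* [augval] sends the generators to a point of [k] where all the relations
   hold. It has no influence on the presented algebra, but shows that the
   latter is nonzero, as required by [algType]. *)
Record presentation (k : fieldType) := Presentation {
  gens : Type;
  rels : term k gens -> term k gens -> Prop;
  augval : gens -> k^o;
  augvalP : forall t u, rels t u -> teval augval t = teval augval u }.

Section PresentedAlgebra.
Variables (k : fieldType) (P : presentation k).

(* The least congruence making terms a unital associative k-algebra in which
   the relations of P hold. *)
Inductive teq : term k (gens P) -> term k (gens P) -> Prop :=
  | teq_rel t u of rels t u : teq t u
  | teq_refl t : teq t t
  | teq_sym t u of teq t u : teq u t
  | teq_trans t u v of teq t u & teq u v : teq t v
  | teq_add t t' u u' of teq t t' & teq u u' : teq (TAdd t u) (TAdd t' u')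
  | teq_mul t t' u u' of teq t t' & teq u u' : teq (TMul t u) (TMul t' u')
  | teq_addA t u v : teq (TAdd t (TAdd u v)) (TAdd (TAdd t u) v)
  | teq_addC t u : teq (TAdd t u) (TAdd u t)
  | teq_add0 t : teq (TAdd (TScal 0) t) t
  | teq_mulA t u v : teq (TMul t (TMul u v)) (TMul (TMul t u) v)
  | teq_mul1l t : teq (TMul (TScal 1) t) t
  | teq_mul1r t : teq (TMul t (TScal 1)) t
  | teq_mul0 t : teq (TMul (TScal 0) t) (TScal 0)
  | teq_mulDl t u v : teq (TMul (TAdd t u) v) (TAdd (TMul t v) (TMul u v))
  | teq_mulDr t u v : teq (TMul t (TAdd u v)) (TAdd (TMul t u) (TMul t v))
  | teq_scalD a b : teq (TScal (a + b)) (TAdd (TScal a) (TScal b))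
  | teq_scalM a b : teq (TScal (a * b)) (TMul (TScal a) (TScal b))
  | teq_scalC a t : teq (TMul (TScal a) t) (TMul t (TScal a)).

Definition teqb : rel (term k (gens P)) := fun t u => `[< teq t u >].

Fact teqb_refl : reflexive teqb.
Proof. by move=> t; apply/asboolP; apply: teq_refl. Qed.

Fact teqb_sym : symmetric teqb.
Proof. by move=> t u; apply/asboolP/asboolP; apply: teq_sym. Qed.

Fact teqb_trans : transitive teqb.
Proof.
by move=> u t v /asboolP tu /asboolP uv; apply/asboolP; apply: teq_trans uv.
Qed.

Canonical teq_equiv := EquivRel teqb teqb_refl teqb_sym teqb_trans.

Definition palg := {eq_quot teq_equiv}.
HB.instance Definition _ := Choice.on palg.
HB.instance Definition _ := EqQuotient.on palg.

Lemma palgP t u : teq t u <-> \pi_palg t = \pi_palg u.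
Proof.
split=> [tu|/eqP]; first by apply/eqP; rewrite eqmodE; apply/asboolP.
by rewrite eqmodE => /asboolP.
Qed.

Lemma repr_teq t : teq (repr (\pi_palg t)) t.
Proof. by apply/palgP; rewrite reprK. Qed.

Definition pgen (x : gens P) : palg := \pi_palg (TGen x).
Definition pscal (a : k) : palg := \pi_palg (TScal a).
Definition padd (u v : palg) : palg := \pi_palg (TAdd (repr u) (repr v)).
Definition pmul (u v : palg) : palg := \pi_palg (TMul (repr u) (repr v)).
Definition popp (u : palg) : palg := pmul (pscal (-1)) u.
Definition pscale (a : k) (u : palg) : palg := pmul (pscal a) u.

Lemma paddE t u : padd (\pi_palg t) (\pi_palg u) = \pi_palg (TAdd t u).
Proof. by apply/palgP/teq_add; apply: repr_teq. Qed.

Lemma pmulE t u : pmul (\pi_palg t) (\pi_palg u) = \pi_palg (TMul t u).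
Proof. by apply/palgP/teq_mul; apply: repr_teq. Qed.

Lemma palgW (Q : palg -> Prop) : (forall t, Q (\pi_palg t)) -> forall u, Q u.
Proof. by move=> H u; rewrite -[u]reprK. Qed.

Let pE := (paddE, pmulE).

Fact paddA : associative padd.
Proof.
elim/palgW=> t; elim/palgW=> u; elim/palgW=> v; rewrite !pE.
by apply/palgP; constructor.
Qed.

Fact paddC : commutative padd.
Proof.
elim/palgW=> t; elim/palgW=> u; rewrite !pE.
by apply/palgP; constructor.
Qed.

Fact padd0 : left_id (pscal 0) padd.
Proof. by elim/palgW=> t; rewrite !pE; apply/palgP; constructor. Qed.

Fact pmulA : associative pmul.
Proof.
elim/palgW=> t; elim/palgW=> u; elim/palgW=> v; rewrite !pE.
by apply/palgP; constructor.
Qed.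

Fact pmul1l : left_id (pscal 1) pmul.
Proof. by elim/palgW=> t; rewrite !pE; apply/palgP; constructor. Qed.

Fact pmul1r : right_id (pscal 1) pmul.
Proof. by elim/palgW=> t; rewrite !pE; apply/palgP; constructor. Qed.

Fact pmul0 u : pmul (pscal 0) u = pscal 0.
Proof. by elim/palgW: u => t; rewrite !pE; apply/palgP; constructor. Qed.

Fact pmulDl : left_distributive pmul padd.
Proof.
elim/palgW=> t; elim/palgW=> u; elim/palgW=> v; rewrite !pE.
by apply/palgP; constructor.
Qed.

Fact pmulDr : right_distributive pmul padd.
Proof.
elim/palgW=> t; elim/palgW=> u; elim/palgW=> v; rewrite !pE.
by apply/palgP; constructor.
Qed.

Fact pscalD a b : pscal (a + b) = padd (pscal a) (pscal b).
Proof. by rewrite !pE; apply/palgP; constructor. Qed.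

Fact pscalM a b : pscal (a * b) = pmul (pscal a) (pscal b).
Proof. by rewrite !pE; apply/palgP; constructor. Qed.

Fact pscalC a u : pmul (pscal a) u = pmul u (pscal a).
Proof. by elim/palgW: u => t; rewrite !pE; apply/palgP; constructor. Qed.

Fact paddN : left_inverse (pscal 0) popp padd.
Proof.
by move=> u; rewrite /popp -{2}[u]pmul1l -pmulDl -pscalD addNr pmul0.
Qed.

HB.instance Definition _ := GRing.isZmodule.Build palg paddA paddC padd0 paddN.

Lemma teq_teval (A : algType k) (f : gens P -> A) :
    (forall t u, rels t u -> teval f t = teval f u) ->
  forall t u, teq t u -> teval f t = teval f u.
Proof.
move=> fP t u; elim=> //=.
- by move=> ? ? ? _ -> _ ->.
- by move=> ? ? ? ? _ -> _ ->.
- by move=> ? ? ? ? _ -> _ ->.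
- by move=> ? ? ?; rewrite addrA.
- by move=> ? ?; rewrite addrC.
- by move=> ?; rewrite scale0r add0r.
- by move=> ? ? ?; rewrite mulrA.
- by move=> ?; rewrite scale1r mul1r.
- by move=> ?; rewrite scale1r mulr1.
- by move=> ?; rewrite scale0r mul0r.
- by move=> ? ? ?; rewrite mulrDl.
- by move=> ? ? ?; rewrite mulrDr.
- by move=> ? ?; rewrite scalerDl.
- by move=> ? ?; rewrite -scalerAl mul1r scalerA.
- by move=> ? ?; rewrite -scalerAl mul1r -scalerAr mulr1.
Qed.

Fact pone_neq0 : pscal 1 != 0.
Proof.
apply/eqP => /palgP /(teq_teval (@augvalP _ P))/= /eqP.
by rewrite scale0r scale1r oner_eq0.
Qed.

HB.instance Definition _ := GRing.Zmodule_isNzRing.Build palg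
  pmulA pmul1l pmul1r pmulDl pmulDr pone_neq0.

Fact pscaleA a b u : pscale a (pscale b u) = pscale (a * b) u.
Proof. by rewrite /pscale pscalM pmulA. Qed.

Fact pscaleDr : right_distributive pscale +%R.
Proof. by move=> a u v; apply: pmulDr. Qed.

Fact pscaleDl u : {morph pscale^~ u : a b / a + b}.
Proof. by move=> a b; rewrite /pscale pscalD pmulDl. Qed.

HB.instance Definition _ := GRing.Zmodule_isLmodule.Build k palg
  pscaleA pmul1l pscaleDr pscaleDl.

Fact pscaleAl (a : k) (u v : palg) : a *: (u * v) = (a *: u) * v.
Proof. exact: pmulA. Qed.

HB.instance Definition _ := GRing.Lmodule_isLalgebra.Build k palg pscaleAl.

Fact pscaleAr (a : k) (u v : palg) : a *: (u * v) = u * (a *: v).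
Proof.
change (pmul (pscal a) (pmul u v) = pmul u (pmul (pscal a) v)).
by rewrite pmulA pscalC -!pmulA.
Qed.

HB.instance Definition _ := GRing.Lalgebra_isAlgebra.Build k palg pscaleAr.

(* The algebra morphism extending f, when f satisfies the relations of P. *)
Definition plift (A : algType k) (f : gens P -> A) (u : palg) : A :=
  teval f (repr u).

Section Lift.
Variables (A : algType k) (f : gens P -> A).
Hypothesis fP : forall t u, rels t u -> teval f t = teval f u.

Lemma plift_pi t : plift f (\pi_palg t) = teval f t.
Proof. exact/(teq_teval fP)/repr_teq. Qed.

Lemma plift_gen x : plift f (pgen x) = f x.
Proof. exact: plift_pi. Qed.

Lemma pliftD u v : plift f (u + v) = plift f u + plift f v.
Proof. by rewrite [LHS]plift_pi. Qed.

Lemma pliftM u v : plift f (u * v) = plift f u * plift f v.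
Proof. by rewrite [LHS]plift_pi. Qed.

Lemma plift_scal a : plift f (pscal a) = a%:A.
Proof. exact: plift_pi. Qed.

Lemma plift1 : plift f 1 = 1.
Proof. by rewrite [LHS]plift_scal scale1r. Qed.

Lemma pliftZ a u : plift f (a *: u) = a *: plift f u.
Proof. by rewrite [LHS]pliftM plift_scal -scalerAl mul1r. Qed.

End Lift.

Lemma plift_unique (A : algType k) (h h' : {lrmorphism palg -> A}) :
  (forall x, h (pgen x) = h' (pgen x)) -> h =1 h'.
Proof.
have scalE a : \pi_palg (TScal a) = a%:A by rewrite -[LHS]pmul1r.
move=> hh'; elim/palgW; elim=> [x|a|t IHt u IHu|t IHt u IHu].
- exact: hh'.
- by rewrite scalE !linearZ/= !rmorph1.
- by rewrite -paddE !raddfD/= IHt IHu.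
- by rewrite -pmulE !rmorphM/= IHt IHu.
Qed.

Definition paug : palg -> k^o := plift (@augval k P).

End PresentedAlgebra.

Section Tensor.
Variables (k : fieldType) (P Q : presentation k).
Notation A := (palg P).
Notation B := (palg Q).

Inductive tensor_rels : term k (A * B) -> term k (A * B) -> Prop :=
  | tensor_addl a a' b : tensor_rels
      (TGen (a + a', b)) (TAdd (TGen (a, b)) (TGen (a', b)))
  | tensor_addr a b b' : tensor_rels
      (TGen (a, b + b')) (TAdd (TGen (a, b)) (TGen (a, b')))
  | tensor_scalel c a b : tensor_rels
      (TGen (c *: a, b)) (TMul (TScal c) (TGen (a, b)))
  | tensor_scaler c a b : tensor_rels
      (TGen (a, c *: b)) (TMul (TScal c) (TGen (a, b)))
  | tensor_one : tensor_rels (TGen (1, 1)) (TScal 1)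
  | tensor_mul a b a' b' : tensor_rels
      (TGen (a * a', b * b')) (TMul (TGen (a, b)) (TGen (a', b'))).

Definition tensor_aug (u : A * B) : k^o := (paug u.1 : k) * paug u.2.

Fact tensor_augP t u :
  tensor_rels t u -> teval tensor_aug t = teval tensor_aug u.
Proof.
have PP := @augvalP k P; have QP := @augvalP k Q.
case=> *; rewrite /= /tensor_aug/= /paug.
- by rewrite pliftD // mulrDl.
- by rewrite pliftD // mulrDr.
- by rewrite pliftZ // /GRing.scale/= mulr1 mulrA.
- by rewrite pliftZ // /GRing.scale/= mulr1 mulrCA.
- by rewrite !plift1 // mulr1 scale1r.
- by rewrite !pliftM //; apply: mulrACA.
Qed.

Definition tensor_presentation := Presentation tensor_augP.
Definition tensor : algType k := palg tensor_presentation.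
Definition tens (a : A) (b : B) : tensor := pgen (P := tensor_presentation) (a, b).

Let tensP (t u : term k (A * B)) :
  tensor_rels t u -> \pi_(palg tensor_presentation) t = \pi u.
Proof. by move=> tu; apply/palgP/teq_rel. Qed.

Lemma tensDl a a' b : tens (a + a') b = tens a b + tens a' b.
Proof. by rewrite [RHS]paddE; apply/tensP/tensor_addl. Qed.

Lemma tensDr a b b' : tens a (b + b') = tens a b + tens a b'.
Proof. by rewrite [RHS]paddE; apply/tensP/tensor_addr. Qed.

Lemma tensZl c a b : tens (c *: a) b = c *: tens a b.
Proof. by rewrite [RHS]pmulE; apply/tensP/tensor_scalel. Qed.

Lemma tensZr c a b : tens a (c *: b) = c *: tens a b.
Proof. by rewrite [RHS]pmulE; apply/tensP/tensor_scaler. Qed.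

Lemma tens11 : tens 1 1 = 1.
Proof. exact/tensP/tensor_one. Qed.

Lemma tensM a b a' b' : tens (a * a') (b * b') = tens a b * tens a' b'.
Proof. by rewrite [RHS]pmulE; apply/tensP/tensor_mul. Qed.

End Tensor.

Definition commutator (k : fieldType) (A : algType k) (u v : A) : A :=
  u * v - v * u.

Section UEA.
Variables (k : fieldType) (g : lmodType k) (br : g -> g -> g).

Inductive uea_rels : term k g -> term k g -> Prop :=
  | uea_add x y : uea_rels (TGen (x + y)) (TAdd (TGen x) (TGen y))
  | uea_scale a x : uea_rels (TGen (a *: x)) (TMul (TScal a) (TGen x))
  | uea_br x y : uea_rels (TGen (br x y))
      (TAdd (TMul (TGen x) (TGen y)) (topp (TMul (TGen y) (TGen x)))).

Fact uea_augP t u : uea_rels t u ->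
  teval (fun=> 0 : k^o) t = teval (fun=> 0 : k^o) u.
Proof. by case=> *; rewrite /= ?mulr0 ?addr0. Qed.

Definition uea_presentation := Presentation uea_augP.
Definition uea : algType k := palg uea_presentation.
Definition uea_gen (x : g) : uea := pgen (P := uea_presentation) x.

Let ueaP (t u : term k g) : uea_rels t u -> \pi_(palg uea_presentation) t = \pi u.
Proof. by move=> tu; apply/palgP/teq_rel. Qed.

Lemma uea_genD x y : uea_gen (x + y) = uea_gen x + uea_gen y.
Proof. by rewrite [RHS]paddE; apply/ueaP/uea_add. Qed.

Lemma uea_genZ a x : uea_gen (a *: x) = a *: uea_gen x.
Proof. by rewrite [RHS]pmulE; apply/ueaP/uea_scale. Qed.

Lemma uea_gen_br x y : uea_gen (br x y) = commutator (uea_gen x) (uea_gen y).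
Proof.
have -> : commutator (uea_gen x) (uea_gen y) = \pi_(palg uea_presentation)
    (TAdd (TMul (TGen x) (TGen y)) (topp (TMul (TGen y) (TGen x)))).
  by rewrite -paddE -!pmulE.
exact/ueaP/uea_br.
Qed.

Section Lift.
Variables (A : algType k) (f : g -> A).
Hypotheses (fD : forall x y, f (x + y) = f x + f y)
  (fZ : forall a x, f (a *: x) = a *: f x)
  (fbr : forall x y, f (br x y) = commutator (f x) (f y)).

Lemma uea_relsP t u : uea_rels t u -> teval f t = teval f u.
Proof.
case=> [x y|a x|x y] /=; first exact: fD.
  by rewrite fZ -scalerAl mul1r.
by rewrite fbr scaleN1r mulN1r.
Qed.

End Lift.

Definition comult_gen (x : g) : tensor uea_presentation uea_presentation :=
  tens (uea_gen x) 1 + tens 1 (uea_gen x).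

Definition comult : uea -> tensor uea_presentation uea_presentation :=
  plift (P := uea_presentation) comult_gen.

Lemma comult_genP t u :
  uea_rels t u -> teval comult_gen t = teval comult_gen u.
Proof.
apply: uea_relsP => [x y|a x|x y]; rewrite /comult_gen.
- by rewrite uea_genD tensDl tensDr addrACA.
- by rewrite uea_genZ tensZl tensZr scalerDr.
- rewrite uea_gen_br /commutator tensDl tensDr -!scaleN1r tensZl tensZr.
  rewrite !mulrDl !mulrDr -!tensM !mulr1 !mul1r !scaleN1r !opprD !addrA.
  by rewrite [RHS](AC 8 (1*5*4*8*(3*6)*(2*7))) /= !subrr !addr0.
Qed.

Definition primitives : set uea :=
  [set u | comult u = tens u 1 + tens 1 u].

End UEA.

Section Defs.
Variable k : fieldType.
Implicit Types (L M : lmodType k) (lam : k) (p : nat).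

Definition lie_algebra L (br : L -> L -> L) : Prop :=
  [/\ forall x, linear (br x),
      forall y, linear (br^~ y),
      forall x, br x x = 0 &
      forall x y z, br x (br y z) + br y (br z x) + br z (br x y) = 0].

Definition rota_baxter lam L (br : L -> L -> L) (R : L -> L) : Prop :=
  linear R /\
  forall x y, br (R x) (R y) =
    R (br (R x) y) + R (br x (R y)) + lam *: R (br x y).

Definition rb_lie_algebra lam L (br : L -> L -> L) (R : L -> L) : Prop :=
  lie_algebra br /\ rota_baxter lam br R.

(* An element of k[t] (x) L is encoded by its sequence of coefficients; this is
   the action on it of ad_(tx + y). *)
Definition ad_txy L (br : L -> L -> L) (x y : L) (v : nat -> L) : nat -> L :=
  fun n => (if n is m.+1 then br x (v m) else 0) + br y (v n).

Definition jacobson_s p L (br : L -> L -> L) (i : nat) (x y : L) : L :=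
  (i%:R : k)^-1 *:
    iter p.-1 (ad_txy br x y) (fun n => if n == 0%N then x else 0) i.-1.

Definition p_map p L (br : L -> L -> L) (pm : L -> L) : Prop :=
  [/\ forall a x, pm (a *: x) = a ^+ p *: pm x,
      forall x y, br (pm x) y = iter p (br x) y &
      forall x y, pm (x + y) =
        pm x + pm y + \sum_(1 <= i < p) jacobson_s p br i x y].

Definition is_composition (n r : nat) (al : r.-tuple 'I_n.+1) : bool :=
  all (fun i : 'I_n.+1 => (0 < i)%N) al && (sumn [seq val i | i <- al] == n).

Definition comp_coef (s : seq nat) : nat :=
  (\prod_(j < size s) 'C((sumn (take j.+1 s)).-1, (nth 0 s j).-1))%N.

Fixpoint iter_br L (br : L -> L -> L) (s : seq L) : L :=
  match s with
  | [::] => 0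
  | [:: x] => x
  | x :: s' => br x (iter_br br s')
  end.

Definition rb_pow L (br : L -> L -> L) (R : L -> L) (x : L) (n : nat) : L :=
  iter n.-1 (br (R x)) x.

Definition p_map_R p lam L (br : L -> L -> L) (pm R : L -> L) (x : L) : L :=
  lam ^+ p.-1 *: pm x +
  \sum_(1 <= r < p) ((r%:R)^-1 * lam ^+ r.-1) *:
    \sum_(al : r.-tuple 'I_p.+1 | is_composition al)
      (comp_coef [seq val i | i <- al])%:R *:
        iter_br br [seq rb_pow br R x (val i) | i <- al].

Definition restricted_rb_lie_algebra p lam L (br : L -> L -> L)
    (pm R : L -> L) : Prop :=
  [/\ rb_lie_algebra lam br R, p_map p br pm &
      forall x, R (p_map_R p lam br pm R x) = pm (R x)].

Definition rb_hom L (brL : L -> L -> L) (RL : L -> L)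
    M (brM : M -> M -> M) (RM : M -> M) (f : L -> M) : Prop :=
  [/\ linear f, forall x y, f (brL x y) = brM (f x) (f y) &
      forall x, f (RL x) = RM (f x)].

Definition restricted_rb_hom L (brL : L -> L -> L) (pmL RL : L -> L)
    M (brM : M -> M -> M) (pmM RM : M -> M) (f : L -> M) : Prop :=
  rb_hom brL RL brM RM f /\ forall x, f (pmL x) = pmM (f x).

Definition rb_p_subalgebra L (br : L -> L -> L) (pm R : L -> L)
    (S : set L) : Prop :=
  [/\ S 0 /\ (forall a x y, S x -> S y -> S (a *: x + y)),
      forall x y, S x -> S y -> S (br x y),
      forall x, S x -> S (R x) &
      forall x, S x -> S (pm x)].

Definition rb_p_closure L (br : L -> L -> L) (pm R : L -> L)
    (E : set L) : set L :=
  smallest (rb_p_subalgebra br pm R) E.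

Definition rb_p_envelope p lam (g : lmodType k) (br : g -> g -> g) (R : g -> g)
    (l : lmodType k) (br' : l -> l -> l) (pm' R' : l -> l) (i : g -> l) :
    Prop :=
  [/\ restricted_rb_lie_algebra p lam br' pm' R',
      rb_hom br R br' R' i,
      injective i &
      rb_p_closure br' pm' R' (range i) = setT].

Definition universal_rb_p_envelope p lam (g : lmodType k) (br : g -> g -> g)
    (R : g -> g) (l : lmodType k) (br' : l -> l -> l) (pm' R' : l -> l)
    (i : g -> l) : Prop :=
  rb_p_envelope p lam br R br' pm' R' i /\
  forall (c : lmodType k) (brc : c -> c -> c) (pmc Rc : c -> c),
    restricted_rb_lie_algebra p lam brc pmc Rc ->
  forall f : g -> c, rb_hom br R brc Rc f ->
  exists! h : l -> c,
    restricted_rb_hom br' pm' R' brc pmc Rc h /\ h \o i = f.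

Definition linspan L (E : set L) : set L :=
  [set v | exists n (a : 'I_n -> k) (e : 'I_n -> L),
     (forall j, E (e j)) /\ v = \sum_(j < n) a j *: e j].

(* Goncharov's extension of R to the enveloping algebra. *)
Definition rb_extension (g : lmodType k) (br : g -> g -> g) (R : g -> g)
    (RU : uea br -> uea br) : Prop :=
  [/\ linear RU,
      forall x, RU (uea_gen br x) = uea_gen br (R x),
      RU 1 = 1 &
      forall x (y : uea br), RU (uea_gen br x * y) =
        RU (uea_gen br x) * RU y - RU (commutator (RU (uea_gen br x)) y)].

End Defs.

Section Gp.
Variables (k : fieldType) (p : nat) (g : lmodType k) (br : g -> g -> g).

Definition gp_set : set (uea br) :=
  linspan [set u | exists x n, u = uea_gen br x ^+ (p ^ n)%N].

Definition gp_pred : {pred uea br} := fun u => `[< gp_set u >].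

Lemma in_gp u : (u \in gp_pred) = `[< gp_set u >].
Proof. by []. Qed.

Fact gp_submod_closed : submod_closed gp_pred.
Proof.
split=> [|c u v]; rewrite !in_gp.
  apply/asboolP; exists 0%N; exists (fun=> 0); exists (fun=> 0).
  by split=> [[]//|]; rewrite big_ord0.
move=> /asboolP[n [a [e [eP ->]]]] /asboolP[m [b [f [fP ->]]]]; apply/asboolP.
pose glue T (h : 'I_n -> T) (h' : 'I_m -> T) j :=
  match fintype.split j with inl j => h j | inr j => h' j end.
exists (n + m)%N; exists (glue _ (fun j => c * a j) b); exists (glue _ e f).
split; first by move=> j; rewrite /glue; case: fintype.split.
rewrite big_split_ord/= scaler_sumr /glue; congr (_ + _); apply: eq_bigr => j _.
  by rewrite (unsplitK (inl _ j)) scalerA.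
by rewrite (unsplitK (inr _ j)).
Qed.

HB.instance Definition _ :=
  GRing.isSubmodClosed.Build k (uea br) gp_pred gp_submod_closed.

Record gp := Gp { gp_val :> uea br; _ : gp_val \in gp_pred }.

HB.instance Definition _ := [isSub for gp_val].
HB.instance Definition _ := [Choice of gp by <:].
HB.instance Definition _ := [SubChoice_isSubLmodule of gp by <:].

End Gp.

Arguments primitives {k g} br.
Arguments gp_set {k} p {g} br.
Arguments gp {k} p {g} br.
Arguments rb_extension {k g} br R RU.

(* Main.v *)
Require Import Defs.
From HB Require Import structures.
From mathcomp Require Import all_boot all_order all_algebra.
From mathcomp Require Import boolp classical_sets functions wochoice.
From mathcomp Require Import zify.

(** Fix a well-ordered basis [e] of [g]. Straightening words by Jacobson's
    argument gives the Poincare-Birkhoff-Witt theorem in the form: a map on the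
    sorted words extends to a linear map on [U(g)]. Evaluating the coproduct of
    a primitive element on pairs of coordinate functions kills every coordinate
    at a sorted word which is not [e_i ^ (p ^ n)], so these powers form a basis
    of the primitive elements.

    With [[x, y]_R = [R x, y] + [x, R y] + [x, y]], both [R] and [R + id] are
    Lie morphisms to [g], and [U(g)] acts on [U(g_R)]; applying this action to
    [1] and then the algebra morphism [U(g_R) -> U(g)] induced by [R] gives the
    extension of [R].

    In weight 1 the operation [x^[p]_R] is [(x + R x)^[p] - (R x)^[p]]: its sum
    over compositions is the expansion of the [s_i (x, R x)] of Jacobson's
    formula. On the other hand [R u * R v = R (u v + [R u, v])], and the
    operator [v |-> u v + [R u, v]] is the difference of the commuting
    operators of left multiplication by [u + R u] and right multiplication by
    [R u], so that [(R u)^p = R ((u + R u)^p - (R u)^p)]. As commutators of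
    primitive elements lie in [g], this propagates from [g] to all
    [x ^ (p ^ n)], and so does compatibility with [R] of the linear map
    [e_i ^ (p ^ n) |-> f(e_i)^[p]^n] giving the universal property. *)

Set Implicit Arguments.
Unset Strict Implicit.
Unset Printing Implicit Defensive.

Import Order.TTheory GRing.Theory.
Local Open Scope ring_scope.
Local Open Scope quotient_scope.
Local Open Scope classical_set_scope.

(** * Submodules and bases *)

Section Submodules.
Variables (k : fieldType) (V : lmodType k).

Definition submodule (S : set V) : Prop :=
  S 0 /\ forall a u v, S u -> S v -> S (a *: u + v).

Section Closure.
Variable S : set V.
Hypothesis subS : submodule S.

Lemma submodule0 : S 0. Proof. by case: subS. Qed.

Lemma submoduleD u v : S u -> S v -> S (u + v).
Proof. by case: subS => _ SP Su Sv; rewrite -[u]scale1r; apply: SP. Qed.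

Lemma submoduleZ a u : S u -> S (a *: u).
Proof. by case: subS => S0 SP Su; rewrite -[_ *: _]addr0; apply: SP. Qed.

Lemma submoduleN u : S u -> S (- u).
Proof. by rewrite -scaleN1r; apply: submoduleZ. Qed.

Lemma submoduleB u v : S u -> S v -> S (u - v).
Proof. by move=> Su Sv; apply/submoduleD/submoduleN. Qed.

Lemma submodule_sum (J : eqType) (s : seq J) (P : pred J) (F : J -> V) :
  (forall j, j \in s -> P j -> S (F j)) -> S (\sum_(j <- s | P j) F j).
Proof.
move=> SF; rewrite big_seq_cond.
apply: big_ind => [||j /andP[]]; [exact: submodule0|exact: submoduleD|].
exact: SF.
Qed.

End Closure.

Definition submod_span (E : set V) : set V := smallest submodule E.

Lemma submod_span_submodule E : submodule (submod_span E).
Proof.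
split=> [S [[]]|a u v Eu Ev S SE] //.
by case: SE.1 => _; apply; [apply: Eu | apply: Ev].
Qed.

End Submodules.

Section LinearMaps.
Variables (k : fieldType) (V W : lmodType k).

Definition linear_pack (f : V -> W) (f_linear : linear f) : {linear V -> W} :=
  HB.pack f (GRing.isLinear.Build k V W *:%R f f_linear).

Lemma linear_zero (f : V -> W) : linear f -> f 0 = 0.
Proof. by move=> f_linear; apply: (linear0 (linear_pack f_linear)). Qed.

Lemma submodule_preimage (f : V -> W) (S : set W) :
  linear f -> submodule S -> submodule (f @^-1` S).
Proof.
move=> f_linear [S0 SP]; split=> [|a u v Su Sv] /=.
  by rewrite linear_zero.
by rewrite f_linear; apply: SP.
Qed.

Lemma submodule_image (f : {linear V -> W}) (S : set V) :
  submodule S -> submodule (f @` S).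
Proof.
move=> [S0 SP]; split=> [|a _ _ [u Su <-] [v Sv <-]].
  by exists 0; rewrite ?linear0.
by exists (a *: u + v); [apply: SP | rewrite linearP].
Qed.

Lemma submodule_eq (f h : V -> W) :
  linear f -> linear h -> submodule [set v | f v = h v].
Proof.
move=> f_linear h_linear; split=> [|a u v /= fu fv].
  by rewrite /= !linear_zero.
by rewrite f_linear h_linear fu fv.
Qed.

End LinearMaps.

Section MultiplicationMaps.
Variables (k : fieldType) (A : algType k).

Lemma mulr_linearl (v : A) : linear (fun u : A => u * v).
Proof. by move=> a u w; rewrite mulrDl -scalerAl. Qed.

Lemma mulr_linearr (v : A) : linear (fun u : A => v * u).
Proof. by move=> a u w; rewrite mulrDr -scalerAr. Qed.

Lemma commutator_linearl (v : A) : linear (@commutator k A ^~ v).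
Proof.
move=> a u w; rewrite /commutator mulr_linearl mulr_linearr.
by rewrite scalerBr opprD addrACA.
Qed.

Lemma commutator_linearr (v : A) : linear (@commutator k A v).
Proof.
move=> a u w; rewrite /commutator mulr_linearl mulr_linearr.
by rewrite scalerBr opprD addrACA.
Qed.

HB.instance Definition _ (v : A) :=
  GRing.isLinear.Build k A A *:%R (commutator v) (commutator_linearr v).

Lemma commutator_anti (u v : A) : commutator u v = - commutator v u.
Proof. by rewrite /commutator opprB. Qed.

End MultiplicationMaps.

Definition is_basis (k : fieldType) (V : lmodType k) (J : Type) (e : J -> V) :
    Prop :=
  (forall v, submod_span (range e) v) /\
  forall (C : lmodType k) (F : J -> C),
    exists f : {linear V -> C}, forall j, f (e j) = F j.

Section LinearExtension.
Variables (k : fieldType) (V : lmodType k) (J : Type) (e : J -> V).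
Hypothesis e_basis : is_basis e.

Lemma basis_ind (S : set V) :
  submodule S -> (forall j, S (e j)) -> forall v, S v.
Proof. by move=> subS Se v; apply: e_basis.1; split=> // _ [j _ <-]. Qed.

Lemma eq_on_basis (C : lmodType k) (f h : V -> C) : linear f -> linear h ->
  (forall j, f (e j) = h (e j)) -> forall v, f v = h v.
Proof.
move=> f_linear h_linear; apply: (basis_ind (S := [set v | f v = h v])).
exact: submodule_eq.
Qed.

Definition lin_ext (C : lmodType k) (F : J -> C) : {linear V -> C} :=
  sval (cid (e_basis.2 C F)).

Lemma lin_ext_basis (C : lmodType k) (F : J -> C) j : lin_ext F (e j) = F j.
Proof. by rewrite /lin_ext; case: cid. Qed.

Lemma lin_ext_unique (C : lmodType k) (F : J -> C) (f : V -> C) :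
  linear f -> (forall j, f (e j) = F j) -> f =1 lin_ext F.
Proof.
move=> f_linear fF; apply: eq_on_basis => // [|j]; first exact: linearP.
by rewrite lin_ext_basis.
Qed.

Lemma eq_lin_ext (C : lmodType k) (F G : J -> C) :
  F =1 G -> lin_ext F =1 lin_ext G.
Proof. by move=> /funext->. Qed.

Lemma lin_ext_is_linear (C : lmodType k) v :
  linear (fun F : J -> C => lin_ext F v).
Proof.
move=> a F G; apply/esym.
apply: (lin_ext_unique (f := a \*: lin_ext F \+ lin_ext G)) => [|j].
  exact: linearP.
by rewrite /= !lin_ext_basis.
Qed.

Lemma lin_extD (C : lmodType k) (F G : J -> C) v :
  lin_ext (fun j => F j + G j) v = lin_ext F v + lin_ext G v.
Proof. by have := lin_ext_is_linear v 1 F G; rewrite !scale1r. Qed.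

Lemma lin_ext0 (C : lmodType k) v : lin_ext (fun=> 0 : C) v = 0.
Proof. exact: (linear_zero (lin_ext_is_linear v)). Qed.

Lemma lin_extZ (C : lmodType k) a (F : J -> C) v :
  lin_ext (fun j => a *: F j) v = a *: lin_ext F v.
Proof. exact: (GRing.scalable_linear (lin_ext_is_linear v)). Qed.

Lemma lin_ext_exchange (C : lmodType k) (G : J -> J -> C) u v :
  lin_ext (fun i => lin_ext (G i) v) u = lin_ext (fun j => lin_ext (G^~ j) u) v.
Proof.
pose f v := lin_ext (fun i => lin_ext (G i) v) u.
apply: (lin_ext_unique (f := f)) => [a w w'|j]; rewrite /f.
  by rewrite -lin_extZ -lin_extD; apply: eq_lin_ext => i; rewrite linearP.
by apply: eq_lin_ext => i; rewrite lin_ext_basis.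
Qed.

End LinearExtension.

Section FiniteCombinations.
Variables (k : fieldType) (V : lmodType k) (J : eqType) (e : J -> V).

Lemma submod_span_finite v : submod_span (range e) v ->
  exists (s : seq J) (a : J -> k), uniq s /\ v = \sum_(j <- s) a j *: e j.
Proof.
pose finite_support u := exists (s : seq J) (a : J -> k),
  forall r, uniq r -> {subset s <= r} -> u = \sum_(j <- r) a j *: e j.
suff supp u : submod_span (range e) u -> finite_support u.
  move=> /supp[s [a vE]]; exists (undup s), a; split; first exact: undup_uniq.
  by apply: vE => [|j]; rewrite ?undup_uniq ?mem_undup.
apply; split=> [|_ [j _ <-]]; last first.
  exists [:: j], (fun i => (i == j)%:R) => r r_uniq jr.
  rewrite (bigD1_seq j) ?jr ?mem_head //= eqxx scale1r big1 ?addr0 // => i.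
  by move=> /negPf->; rewrite scale0r.
split=> [|c {}u w [s [a uE]] [t [b wE]]].
  by exists [::], (fun=> 0) => r _ _; rewrite big1 // => j _; rewrite scale0r.
exists (s ++ t), (fun j => c * a j + b j) => r r_uniq str.
rewrite (uE r) // ?(wE r) // => [|j jt|j js]; last 2 first.
- by apply: str; rewrite mem_cat jt orbT.
- by apply: str; rewrite mem_cat js.
rewrite scaler_sumr -big_split; apply: eq_bigr => j _.
by rewrite scalerDl scalerA.
Qed.

Definition free_family : Prop :=
  forall (s : seq J) (a : J -> k), uniq s ->
  \sum_(j <- s) a j *: e j = 0 -> forall j, j \in s -> a j = 0.

End FiniteCombinations.

Section FreeBasis.
Variables (k : fieldType) (V : lmodType k) (J : eqType) (e : J -> V).
Hypothesis e_free : free_family e.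

Lemma free_basis : (forall v, submod_span (range e) v) -> is_basis e.
Proof.
move=> e_span; split=> // C F.
pose graph : set (V * C) := submod_span (range (fun j => (e j, F j))).
have graph_sub : submodule graph by apply: submod_span_submodule.
have graph_e j : graph (e j, F j) by move=> T [_]; apply; exists j.
have graph0 c : graph (0, c) -> c = 0.
  move=> /submod_span_finite[s [a [s_uniq]]] /[dup].
  move=> /(congr1 fst); rewrite linear_sum => /esym /= /(e_free s_uniq) a0.
  move=> /(congr1 snd); rewrite linear_sum /= => ->.
  by rewrite big_seq big1 // => j js; rewrite a0 // scale0r.
have graph_total v : exists c, graph (v, c).
  apply: (e_span v (fun v => exists c, graph (v, c))); split=> [|_ [j _ <-]].
    split=> [|a u w [c uc] [d wd]].
      by exists 0; exact: (submodule0 graph_sub).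
    by exists (a *: c + d); exact: (graph_sub.2 a (u, c) (w, d) uc wd).
  by exists (F j).
have graph_fun v c d : graph (v, c) -> graph (v, d) -> c = d.
  move=> vc vd; apply/eqP; rewrite -subr_eq0; apply/eqP/graph0.
  rewrite -(subrr v); exact: (submoduleB graph_sub vc vd).
have [f fP] := choice graph_total.
have f_linear : linear f.
  move=> a u v; apply: (graph_fun (a *: u + v)) => //.
  exact: (graph_sub.2 a (u, f u) (v, f v)).
by exists (linear_pack f_linear) => j; apply: (graph_fun (e j)).
Qed.

End FreeBasis.

Section Coordinates.
Variables (k : fieldType) (V : lmodType k) (J : eqType) (e : J -> V).
Hypothesis e_basis : is_basis e.

Definition basis_coord (j : J) : {linear V -> k^o} :=
  lin_ext e_basis (fun i => (i == j)%:R).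

Lemma basis_coordE i j : basis_coord j (e i) = (i == j)%:R.
Proof. exact: lin_ext_basis. Qed.

Lemma basis_coord_sum v :
  exists s : seq J, v = \sum_(j <- s) basis_coord j v *: e j.
Proof.
have [s [a [s_uniq vE]]] := submod_span_finite (e_basis.1 v); exists s.
rewrite {1}vE [in LHS]big_seq [in RHS]big_seq; apply: eq_bigr => j js.
congr (_ *: _); rewrite vE linear_sum (bigD1_seq j) //= linearZ basis_coordE.
rewrite eqxx [RHS]addrC big1 ?add0r ?[RHS]mulr1 // => i /negPf ij.
by rewrite linearZ basis_coordE ij [LHS]mulr0.
Qed.

Lemma basis_coord_ind (S : set V) v : submodule S ->
  (forall j, basis_coord j v != 0 -> S (e j)) -> S v.
Proof.
move=> subS Se; have [s ->] := basis_coord_sum v.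
apply: (submodule_sum subS) => j _ _.
have [->|/Se] := eqVneq (basis_coord j v) 0; last exact: submoduleZ.
by rewrite scale0r; apply: submodule0.
Qed.

End Coordinates.

Section OrderedBasis.
Variables (k : fieldType) (V : lmodType k) (d : Order.disp_t) (I : orderType d).

Lemma free_triangular (e : I -> V) :
  (forall i, ~ submod_span (e @` [set j | (j < i)%O]) (e i)) -> free_family e.
Proof.
move=> e_indep s a s_uniq.
have s_perm : perm_eq (sort <=%O s) s by rewrite perm_sort.
rewrite -(perm_big _ s_perm) => /= s0 i; rewrite -(perm_mem s_perm); move: i.
have : sorted <%O (sort <=%O s) by rewrite sort_lt_sorted.
elim/last_ind: (sort _ s) s0 => // {s_uniq s_perm}t m IHt.
rewrite -cats1 big_cat big_seq1 (sorted_pairwise lt_trans) cats1.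
rewrite pairwise_rcons => /= tm0 /andP[/allP tm t_sorted].
have am0 : a m = 0.
  apply: contrapT => /eqP am0; apply: (e_indep m) => S [subS Se].
  have -> : e m = - ((a m)^-1 *: \sum_(j <- t) a j *: e j).
    by rewrite (canRL (addrK _) tm0) sub0r scalerN opprK scalerA mulVf ?scale1r.
  apply: (submoduleN subS); apply: (submoduleZ subS).
  apply: (submodule_sum subS) => j jt _; apply: (submoduleZ subS).
  by apply: Se; exists j => //; apply: tm.
rewrite am0 scale0r addr0 in tm0 => i.
rewrite mem_rcons inE => /predU1P[->//|].
by apply: IHt => //; rewrite (sorted_pairwise lt_trans).
Qed.

End OrderedBasis.

Lemma well_order_transitive (T : eqType) (R : rel T) :
  well_order R -> transitive R.
Proof.
move=> R_wo y x z Rxy Ryz.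
have R_chain : wo_chain R (mem T) by move=> A _; apply: R_wo.
have R_anti u v : R u v && R v u -> u = v.
  exact: (wo_chain_antisymmetric R_chain).
have [|m [[mA m_min] _]] := R_wo (mem [:: x; y; z]).
  by exists x; apply: mem_head.
move: mA m_min; rewrite !inE => /or3P[]/eqP-> m_min.
- by apply: m_min; rewrite !inE eqxx !orbT.
- by have -> // : x = y by apply: R_anti; rewrite Rxy m_min ?inE ?eqxx ?orbT.
- by have <- // : y = z by apply: R_anti; rewrite Ryz m_min ?inE ?eqxx ?orbT.
Qed.

(* For a well-ordering of V, the vectors which are not in the span of the
   smaller ones form a basis. *)
Lemma exists_ordered_basis (k : fieldType) (V : lmodType k) :
  exists (d : Order.disp_t) (I : orderType d) (e : I -> V), is_basis e.
Proof.
have [R R_wo] := well_ordering_principle V.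
have R_chain : wo_chain R (mem V) by move=> A _; apply: R_wo.
pose smaller x := [set y | R y x && (y != x)].
pose B : {pred V} := fun x => `[< ~ submod_span (smaller x) x >].
pose T : choiceType := {x : V | x \in B}.
have T_refl : reflexive (relpre val R : rel T).
  by move=> i; apply: (wo_chain_reflexive R_chain).
have T_anti : antisymmetric (relpre val R : rel T).
  by move=> i j /(wo_chain_antisymmetric R_chain)-/(_ isT isT)/val_inj.
have T_trans : transitive (relpre val R : rel T).
  by move=> j i l; apply: (well_order_transitive R_wo).
have T_total : total (relpre val R : rel T).
  by move=> i j; apply: (wo_chainW R_chain).
pose disp := Order.Disp tt tt.
pose P : porderType disp := HB.pack T
  (Order.Le_isPOrder.Build disp T T_refl T_anti T_trans).
pose I : orderType disp := HB.pack P
  (Order.POrder_isTotal.Build disp P T_total).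
exists disp, I, val; apply: free_basis.
  apply: free_triangular => i iS; have /asboolP := valP i; apply => S [subS Si].
  apply: iS; split=> // _ [j ji <-]; apply: Si.
  by move: ji; rewrite /= lt_neqAle => /andP[ji Rji]; apply/andP.
move=> v S [subS SB]; apply: contrapT => NSv.
have [|m [[/asboolP NSm m_min] _]] := R_wo (fun x => `[< ~ S x >]).
  by exists v; apply/asboolP.
have [mB|/asboolPn/contrapT m_span] := boolP (m \in B).
  by apply: NSm; apply: SB; exists (Sub m mB : T).
apply: NSm; apply: m_span; split=> // z /andP[Rzm zm]; apply: contrapT => NSz.
case/eqP: zm; apply: (wo_chain_antisymmetric R_chain) => //.
by rewrite Rzm m_min //; apply/asboolP.
Qed.

(** * Modules over a presented algebra *)

Section PresentedModules.
Variables (k : fieldType) (P : presentation k) (W : lmodType k).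

Fixpoint term_act (rho : gens P -> W -> W) (t : term k (gens P)) (w : W) : W :=
  match t with
  | TGen x => rho x w
  | TScal a => a *: w
  | TAdd t u => term_act rho t w + term_act rho u w
  | TMul t u => term_act rho t (term_act rho u w)
  end.

(* Asking for linearity and for the relations of P only on S makes it possible
   to let rho act on the linear maps, among all the functions. *)
Definition presented_module (S : set W) (rho : gens P -> W -> W) : Prop :=
  [/\ submodule S,
      forall x w, S w -> S (rho x w),
      forall x a u v, S u -> S v -> rho x (a *: u + v) = a *: rho x u + rho x v
    & forall t u w, rels t u -> S w -> term_act rho t w = term_act rho u w].

Definition palg_act (rho : gens P -> W -> W) (u : palg P) (w : W) : W :=
  term_act rho (repr u) w.

Variables (S : set W) (rho : gens P -> W -> W).
Hypothesis rhoP : presented_module S rho.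

Let subS : submodule S. Proof. by case: rhoP. Qed.

Lemma term_act_closed t w : S w -> S (term_act rho t w).
Proof.
have [_ rhoS _ _] := rhoP.
elim: t w => /= [x|a|t IHt u IHu|t IHt u IHu] w Sw.
- exact: rhoS.
- exact: submoduleZ.
- by apply: submoduleD => //; [apply: IHt | apply: IHu].
- by apply/IHt/IHu.
Qed.

Lemma term_actP t a u v : S u -> S v ->
  term_act rho t (a *: u + v) = a *: term_act rho t u + term_act rho t v.
Proof.
have [_ _ rho_linear _] := rhoP.
elim: t u v => /= [x|b|t IHt t' IHt'|t IHt t' IHt'] u v Su Sv.
- exact: rho_linear.
- by rewrite scalerDr !scalerA mulrC.
- by rewrite IHt // IHt' // scalerDr addrACA.
- by rewrite IHt' // IHt //; apply: term_act_closed.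
Qed.

Lemma term_actD t u v : S u -> S v ->
  term_act rho t (u + v) = term_act rho t u + term_act rho t v.
Proof. by move=> Su Sv; rewrite -[u]scale1r term_actP // !scale1r. Qed.

Lemma term_actZ t a u : S u -> term_act rho t (a *: u) = a *: term_act rho t u.
Proof.
move=> Su; have S0 := submodule0 subS.
have act0 : term_act rho t 0 = 0.
  by apply: (addrI (term_act rho t 0)); rewrite -term_actD // !addr0.
by rewrite -[a *: u]addr0 term_actP // act0 addr0.
Qed.

Lemma teq_term_act t u :
  teq t u -> forall w, S w -> term_act rho t w = term_act rho u w.
Proof.
have [_ _ _ rho_rels] := rhoP.
elim=> {t u} //= [t u tu|t u _ IH|t u v _ IH _ IH'|t t' u u' _ IH _ IH'
  |t t' u u' _ IH _ IH'|t u v|t u|t|t|t|t|t u v|a b|a b|a t] w Sw.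
- exact: rho_rels.
- by rewrite IH.
- by rewrite IH // IH'.
- by rewrite IH // IH'.
- by rewrite IH' // IH //; apply: term_act_closed.
- by rewrite addrA.
- by rewrite addrC.
- by rewrite scale0r add0r.
- by rewrite scale1r.
- by rewrite scale1r.
- by rewrite !scale0r.
- by rewrite term_actD //; apply: term_act_closed.
- by rewrite scalerDl.
- by rewrite scalerA.
- by rewrite term_actZ.
Qed.

Lemma palg_act_pi t w :
  S w -> palg_act rho (\pi_(palg P) t) w = term_act rho t w.
Proof. exact/teq_term_act/repr_teq. Qed.

Lemma palg_act_closed u w : S w -> S (palg_act rho u w).
Proof. exact: term_act_closed. Qed.

Lemma palg_act_gen x w : S w -> palg_act rho (pgen x) w = rho x w.
Proof. exact: palg_act_pi. Qed.

Lemma palg_actM u v w :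
  S w -> palg_act rho (u * v) w = palg_act rho u (palg_act rho v w).
Proof. by move=> Sw; rewrite [LHS]palg_act_pi. Qed.

Lemma palg_act1 w : S w -> palg_act rho 1 w = w.
Proof. by move=> Sw; rewrite [LHS]palg_act_pi //= scale1r. Qed.

Lemma palg_act_linear w : S w -> linear (palg_act rho ^~ w).
Proof.
move=> Sw a u v; rewrite [LHS]palg_act_pi //=; congr (_ + _).
rewrite -[LHS]/(palg_act rho (pscal P a * u) w) palg_actM //.
by rewrite [LHS]palg_act_pi //; apply: palg_act_closed.
Qed.

End PresentedModules.

Lemma palg_ind (k : fieldType) (P : presentation k) (S : set (palg P)) :
  submodule S -> S 1 -> (forall x u, S u -> S (pgen x * u)) -> forall u, S u.
Proof.
move=> subS S1 SM; suff SMt t u : S u -> S (\pi_(palg P) t * u).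
  by elim/palgW=> t; rewrite -[\pi_(palg P) t]mulr1; apply: SMt.
elim: t u => [x|a|t IHt t' IHt'|t IHt t' IHt'] u Su.
- exact: SM.
- exact: (submoduleZ subS a Su).
- by rewrite -paddE mulrDl; apply: submoduleD; [|apply: IHt|apply: IHt'].
- by rewrite -pmulE -mulrA; apply/IHt/IHt'.
Qed.

Lemma uea_gen_linear (k : fieldType) (g : lmodType k) (br : g -> g -> g) :
  linear (uea_gen br).
Proof. by move=> a x y; rewrite uea_genD uea_genZ. Qed.

HB.instance Definition _ (k : fieldType) (g : lmodType k) (br : g -> g -> g) :=
  GRing.isLinear.Build k g (uea br) *:%R (uea_gen br) (uea_gen_linear br).

Notation uea_module br := (@presented_module _ (uea_presentation br) _).
Notation uea_act br := (@palg_act _ (uea_presentation br) _).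
Notation uea_term_act br := (@term_act _ (uea_presentation br) _).

(** * The Poincare-Birkhoff-Witt theorem *)

Section LieAlgebra.
Variables (k : fieldType) (g : lmodType k) (br : g -> g -> g).
Hypothesis brL : lie_algebra br.

Lemma lie_linearr x : linear (br x). Proof. by case: brL. Qed.
Lemma lie_linearl y : linear (br^~ y). Proof. by case: brL. Qed.
Lemma lie_xx x : br x x = 0. Proof. by case: brL. Qed.

HB.instance Definition _ x :=
  GRing.isLinear.Build k g g *:%R (br x) (lie_linearr x).

Lemma lieDl x y z : br (x + y) z = br x z + br y z.
Proof. by rewrite -[x]scale1r lie_linearl !scale1r. Qed.
Lemma lieDr x y z : br x (y + z) = br x y + br x z.
Proof. exact: linearD. Qed.
Lemma lie0r x : br x 0 = 0. Proof. exact: linear0. Qed.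
Lemma lieNr x y : br x (- y) = - br x y. Proof. exact: linearN. Qed.
Lemma lieZr a x y : br x (a *: y) = a *: br x y.
Proof. exact: linearZ. Qed.
Lemma lie_sumr (J : Type) (s : seq J) (P : pred J) (F : J -> g) x :
  br x (\sum_(j <- s | P j) F j) = \sum_(j <- s | P j) br x (F j).
Proof. exact: linear_sum. Qed.

Lemma lie_anti x y : br x y = - br y x.
Proof.
apply/eqP; rewrite -addr_eq0; apply/eqP; have := lie_xx (x + y).
by rewrite lieDl !lieDr !lie_xx add0r addr0.
Qed.

Lemma lie_jacobi x y z : br x (br y z) = br (br x y) z + br y (br x z).
Proof.
case: brL => _ _ _ /(_ x y z) J.
apply/eqP; rewrite -subr_eq0 opprD addrA -J.
by rewrite [br (br x y) z]lie_anti opprK (lie_anti x z) lieNr opprK addrAC.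
Qed.

End LieAlgebra.

Section Words.
Variables (d : Order.disp_t) (I : orderType d).
Implicit Types (x y z t : I) (a b m w : seq I).

Fixpoint first_descent w : option (seq I * I * I * seq I) :=
  if w is x :: w' then
    if w' is y :: b then
      if (x <= y)%O then
        omap (fun '(a, x', y', b') => (x :: a, x', y', b')) (first_descent w')
      else Some ([::], x, y, b)
    else None
  else None.

Lemma first_descent_cons2 x y b : first_descent (x :: y :: b) =
  if (x <= y)%O then
    omap (fun '(a, x', y', b') => (x :: a, x', y', b')) (first_descent (y :: b))
  else Some ([::], x, y, b).
Proof. by []. Qed.

Lemma first_descent_sorted w : (first_descent w == None) = sorted <=%O w.
Proof.
elim: w => // x [|y b] // IH; rewrite first_descent_cons2 [RHS]/=.
case: (x <= y)%O => //; rewrite andTb -[path _ _ _]/(sorted <=%O (y :: b)) -IH.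
by case: (first_descent (y :: b)) => // -[[[]]].
Qed.

Lemma first_descentP w a x y b : first_descent w = Some (a, x, y, b) ->
  w = a ++ x :: y :: b /\ (y < x)%O.
Proof.
elim: w a x y b => // z [|t c] // IH a x y b; rewrite first_descent_cons2.
case: ifP => [_|/negbT]; last by rewrite -ltNge => tz [<- <- <- <-].
case: (first_descent (t :: c)) IH => // -[[[a' x'] y'] b'] IH [<- <- <- <-].
by have [-> ?] := IH _ _ _ _ erefl.
Qed.

Lemma first_descent_cat a x y b : (y < x)%O ->
  [\/ first_descent (a ++ x :: y :: b) = Some (a, x, y, b),
      exists a' z, [/\ a = rcons a' z, (x < z)%O &
        first_descent (a ++ x :: y :: b) = Some (a', z, x, y :: b)] |
      exists a' z t m, [/\ a = a' ++ z :: t :: m, (t < z)%O &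
        first_descent (a ++ x :: y :: b) =
          Some (a', z, t, m ++ x :: y :: b)]].
Proof.
move=> yx; elim: a => [|z [|t c] IH].
- by constructor 1; rewrite /= leNgt yx.
- have [zx|xz] := leP z x.
    by constructor 1; rewrite /= zx leNgt yx.
  by constructor 2; exists [::], z; rewrite /= leNgt xz.
- have [zt|tz] := leP z t; last first.
    by constructor 3; exists [::], z, t, c; rewrite /= leNgt tz.
  have -> : first_descent ((z :: t :: c) ++ x :: y :: b) =
      omap (fun '(a, x', y', b') => (z :: a, x', y', b'))
        (first_descent ((t :: c) ++ x :: y :: b)) by rewrite /= zt.
  case: IH => [->|[a' [u [-> xu ->]]]|[a' [u [v [m [-> vu ->]]]]]].
  + by constructor 1.
  + by constructor 2; exists (z :: a'), u.
  + by constructor 3; exists (z :: a'), u, v, m.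
Qed.

Fixpoint inversions w : nat :=
  if w is x :: w' then (count (fun y => (y < x)%O) w' + inversions w')%N
  else 0%N.

Lemma inversions_le w : (inversions w <= size w ^ 2)%N.
Proof.
elim: w => //= x w IH; apply: leq_trans (leq_add (count_size _ _) IH) _.
by rewrite -[(size w).+1]addn1 sqrnD; lia.
Qed.

(* As there are at most [n ^ 2] inversions in a word of length [n], this orders
   the words by length, then by number of inversions. *)
Definition word_measure w : nat := (size w ^ 3 + inversions w)%N.

Lemma word_measure_size a b :
  (size a < size b)%N -> (word_measure a < word_measure b)%N.
Proof.
rewrite /word_measure => ab; have := inversions_le a.
have : ((size a).+1 ^ 3 <= size b ^ 3)%N by rewrite leq_exp2r.
by rewrite !expnS expn0; nia.
Qed.

Lemma word_measure_shrink a x y z b :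
  (word_measure (a ++ z :: b) < word_measure (a ++ x :: y :: b))%N.
Proof. by apply: word_measure_size; rewrite !size_cat /= !addnS. Qed.

Lemma word_measure_swap a x y b : (y < x)%O ->
  (word_measure (a ++ y :: x :: b) < word_measure (a ++ x :: y :: b))%N.
Proof.
move=> yx; rewrite /word_measure !size_cat /= ltn_add2l.
elim: a => /= [|z a IH]; last by rewrite !count_cat /=; lia.
by rewrite yx (ltNge x y) (ltW yx) /=; lia.
Qed.

End Words.

Section Straightening.
Variables (k : fieldType) (g : lmodType k) (br : g -> g -> g).
Hypothesis brL : lie_algebra br.
Variables (d : Order.disp_t) (I : orderType d) (e : I -> g).
Hypothesis e_basis : is_basis e.
Variable C : lmodType k.
Implicit Types (s : seq I -> C) (x y z t : I) (a b m w : seq I).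

(* The value of s, extended linearly, at the word obtained by inserting a vector
   of g between a and b. *)
Definition slot s a b : {linear g -> C} :=
  lin_ext e_basis (fun c => s (a ++ c :: b)).

Definition straightened s a x y b : Prop :=
  s (a ++ x :: y :: b) =
  s (a ++ y :: x :: b) + slot s a b (br (e x) (e y)).

Lemma straightened_xx s a x b : straightened s a x x b.
Proof. by rewrite /straightened (lie_xx brL) linear0 addr0. Qed.

Lemma straightened_sym s a x y b :
  straightened s a x y b -> straightened s a y x b.
Proof.
rewrite /straightened => ->; rewrite -addrA [br (e y) _](lie_anti brL).
by rewrite linearN subrr addr0.
Qed.

Lemma straightened_descent s a x y b :
    ((y < x)%O -> straightened s a x y b) ->
    ((x < y)%O -> straightened s a y x b) ->
  straightened s a x y b.
Proof.
case: (ltgtP x y) => [_ _ yx|_ xy _|-> _ _]; last exact: straightened_xx.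
  by apply/straightened_sym/yx.
exact: xy.
Qed.

Lemma slot_basis s a b c : slot s a b (e c) = s (a ++ c :: b).
Proof. exact: lin_ext_basis. Qed.

Lemma slot_exchange s a y b u : (forall c, straightened s a c y b) ->
  slot s a (y :: b) u = slot s (rcons a y) b u + slot s a b (br u (e y)).
Proof.
move=> s_straight; move: u; apply: (eq_on_basis e_basis) => [|c u v|c].
- exact: linearP.
- by rewrite !linearP (lie_linearl brL) linearP scalerDr addrACA.
- by rewrite !slot_basis cat_rcons s_straight.
Qed.

(* Five sides of the hexagon of the permutations of [z > x > y] give the sixth
   one: the brackets met along the way add up to the Jacobi identity. *)
Lemma straightened_hexagon s a x y z b :
    (forall c t, straightened s a c t b) ->
    straightened s a z x (y :: b) -> straightened s (rcons a x) z y b ->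
    straightened s a x y (z :: b) -> straightened s a z y (x :: b) ->
    straightened s (rcons a y) z x b ->
  straightened s (rcons a z) x y b.
Proof.
rewrite /straightened !cat_rcons => shorter zx zy xy zy' zx'.
rewrite zx zy xy zy' zx' !(slot_exchange _ (fun c => shorter c _)).
have <- : slot s a b (br (br (e z) (e x)) (e y)) +
    slot s a b (br (br (e x) (e y)) (e z)) =
    slot s a b (br (br (e z) (e y)) (e x)).
  rewrite -linearD; congr (slot _ _ _ _).
  rewrite [br (br (e x) _) _](lie_anti brL) (lie_jacobi brL (e z)) opprD.
  by rewrite addrA subrr sub0r (lie_anti brL) opprK.
by rewrite !addrA [LHS](ACl (1*5*4*6*3*2)).
Qed.

Lemma straightened_square s a z t m x y b :
    (forall c, straightened s (a ++ c :: m) x y b) ->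
    (forall c, straightened s a z t (m ++ c :: b)) ->
    straightened s a z t (m ++ x :: y :: b) ->
    straightened s (a ++ t :: z :: m) x y b ->
    straightened s a z t (m ++ y :: x :: b) ->
  straightened s (a ++ z :: t :: m) x y b.
Proof.
move=> xy_short zt_short zt xy' zt'; move: xy'.
rewrite /straightened -!catA /= zt zt' => ->.
have -> : slot s a (m ++ x :: y :: b) (br (e z) (e t)) =
    slot s a (m ++ y :: x :: b) (br (e z) (e t)) +
    lin_ext e_basis (fun c => slot s (a ++ c :: m) b (br (e x) (e y)))
      (br (e z) (e t)).
  rewrite -lin_extD; apply: eq_lin_ext => c.
  by have := xy_short c; rewrite /straightened -!catA.
have -> : slot s (a ++ z :: t :: m) b (br (e x) (e y)) =
    slot s (a ++ t :: z :: m) b (br (e x) (e y)) +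
    lin_ext e_basis (fun c => slot s a (m ++ c :: b) (br (e z) (e t)))
      (br (e x) (e y)).
  rewrite -lin_extD; apply: eq_lin_ext => c.
  by have := zt_short c; rewrite /straightened -!catA.
rewrite lin_ext_exchange !addrA [LHS](ACl (1*3*2*4)); congr (_ + _).
by apply: eq_lin_ext => c; apply: eq_lin_ext => c'; rewrite -catA.
Qed.

Section Recursion.
Variable tau : seq I -> C.

Fixpoint straighten_rec (n : nat) (w : seq I) : C :=
  if n is n'.+1 then
    if first_descent w is Some (a, x, y, b) then
      straighten_rec n' (a ++ y :: x :: b) +
      slot (straighten_rec n') a b (br (e x) (e y))
    else tau w
  else 0.

Definition straighten w := straighten_rec (word_measure w).+1 w.

Lemma straighten_recE n w :
  (word_measure w < n)%N -> straighten_rec n w = straighten w.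
Proof.
suff fuel l : (word_measure w < l)%N -> (word_measure w < n)%N ->
  straighten_rec n w = straighten_rec l w by apply: fuel.
elim: n l w => // n IH [//|l] w wl wn /=.
case D: first_descent => [[[[a x] y] b]|] //.
have [wE yx] := first_descentP D; rewrite wE in wl wn.
congr (_ + _); last apply: eq_lin_ext => c.
  by apply: IH; apply: leq_trans (word_measure_swap a b yx) _.
by apply: IH; apply: leq_trans (word_measure_shrink a x y c b) _.
Qed.

Lemma straighten_sorted w : sorted <=%O w -> straighten w = tau w.
Proof. by rewrite -first_descent_sorted /straighten /= => /eqP->. Qed.

Lemma straighten_first a x y b :
  first_descent (a ++ x :: y :: b) = Some (a, x, y, b) ->
  straightened straighten a x y b.
Proof.
move=> D; have [_ yx] := first_descentP D.
rewrite /straightened {1}/straighten /= D straighten_recE; last first.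
  exact: word_measure_swap.
congr (_ + _); apply: eq_lin_ext => c.
by rewrite straighten_recE // word_measure_shrink.
Qed.

(* The first descent of a word satisfies [straightened] by definition. Any other
   one overlaps it or is disjoint from it, and the equation follows from those
   at smaller words. *)
Lemma straighten_straightened a x y b : straightened straighten a x y b.
Proof.
suff descent n : forall a x y b, (y < x)%O ->
    (word_measure (a ++ x :: y :: b) < n)%N -> straightened straighten a x y b.
  by apply: straightened_descent => /descent; apply; apply: ltnSn.
elim: n => // n IH {}a {}x {}y {}b yx; rewrite ltnS => wn.
have shorter a' x' y' b' :
    (size (a' ++ x' :: y' :: b') < size (a ++ x :: y :: b))%N ->
    straightened straighten a' x' y' b'.
  move=> shorter; apply: straightened_descent => xy'; apply: IH => //;
    apply: leq_trans wn; apply: word_measure_size; move: shorter;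
    by rewrite !size_cat.
have smaller w : (word_measure w < word_measure (a ++ x :: y :: b))%N ->
  (word_measure w < n)%N by move=> /leq_trans; apply.
have [/straighten_first//|[a' [z [aE xz D]]]|[a' [z [t [m [aE tz D]]]]]] :=
  first_descent_cat a b yx.
  rewrite {}aE cat_rcons in shorter smaller D *.
  have yz := lt_trans yx xz.
  have swap_zx := word_measure_swap a' (y :: b) xz.
  have swap_xy := word_measure_swap (rcons a' z) b yx.
  have swap_zy := word_measure_swap (rcons a' x) b yz.
  have swap_zy' := word_measure_swap a' (x :: b) yz.
  rewrite !cat_rcons in swap_xy swap_zy.
  apply: straightened_hexagon => [c t|||||].
  - by apply: shorter; rewrite !size_cat /= !addnS ltnS.
  - exact: straighten_first.
  - by apply: IH => //; rewrite cat_rcons; apply: smaller.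
  - by apply: IH => //; apply/smaller/(ltn_trans swap_zy).
  - by apply: IH => //; apply: smaller.
  - by apply: IH => //; rewrite cat_rcons; apply/smaller/(ltn_trans swap_zy').
rewrite {}aE -catA /= in shorter smaller D *.
apply: straightened_square => [c|c|||].
- by apply: shorter; rewrite !size_cat /= !size_cat /=; lia.
- by apply: shorter; rewrite !size_cat /= !size_cat /=; lia.
- exact: straighten_first.
- by apply: IH => //; rewrite -catA; apply/smaller/word_measure_swap.
apply: IH => //; apply: smaller.
by have := word_measure_swap (a' ++ z :: t :: m) b yx; rewrite -!catA.
Qed.

End Recursion.
End Straightening.

Section UEAWords.
Variables (k : fieldType) (g : lmodType k) (br : g -> g -> g).
Variables (I : Type) (e : I -> g).
Notation U := (uea br).
Notation gen := (uea_gen br).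

Definition uea_word (w : seq I) : U := \prod_(i <- w) gen (e i).

Lemma uea_word_nil : uea_word [::] = 1.
Proof. exact: big_nil. Qed.

Lemma uea_word_cons i w : uea_word (i :: w) = gen (e i) * uea_word w.
Proof. exact: big_cons. Qed.

Lemma uea_word1 i : uea_word [:: i] = gen (e i).
Proof. exact: big_seq1. Qed.

Lemma uea_word_cat v w : uea_word (v ++ w) = uea_word v * uea_word w.
Proof. exact: big_cat. Qed.

Lemma uea_word_nseq n i : uea_word (nseq n i) = gen (e i) ^+ n.
Proof. by rewrite [LHS]big_nseq -Monoid.iteropE. Qed.

End UEAWords.

Section PBWBasis.
Variables (k : fieldType) (g : lmodType k) (br : g -> g -> g).
Hypothesis brL : lie_algebra br.
Variables (d : Order.disp_t) (I : orderType d) (e : I -> g).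
Hypothesis e_basis : is_basis e.
Notation U := (uea br).
Notation gen := (uea_gen br).
Notation word := (uea_word br e).

Lemma uea_word_straightened a x y b : straightened br e_basis word a x y b.
Proof.
have slotE v : slot e_basis word a b v = word a * (gen v * word b).
  apply/esym; move: v.
  apply: (lin_ext_unique _ (f := word a \*o (word b \o* gen))) => [|c].
    exact: linearP.
  by rewrite uea_word_cat uea_word_cons.
rewrite /straightened slotE uea_gen_br /commutator !uea_word_cat.
by rewrite !uea_word_cons mulrBl mulrBr !mulrA addrC subrK.
Qed.

Lemma uea_word_mem (S : set U) : submodule S ->
  (forall w, sorted <=%O w -> S (word w)) -> forall w, S (word w).
Proof.
move=> subS Ssorted w.
have [n] := ubnP (word_measure w); elim: n w => // n IH w; rewrite ltnS => wn.
have := first_descent_sorted w.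
case D: first_descent => [[[[a x] y] b]|]; last by move/esym/Ssorted.
have [wE yx] := first_descentP D; rewrite wE in wn * => _.
rewrite uea_word_straightened; apply: submoduleD => //.
  by apply: IH; apply: leq_trans wn; apply: word_measure_swap.
move: (br _ _); apply: (basis_ind e_basis) => [|c].
  by apply: (submodule_preimage _ subS); apply: linearP.
rewrite /= slot_basis; apply: IH; apply: leq_trans wn.
exact: word_measure_shrink.
Qed.

Lemma uea_word_ind (S : set U) :
  submodule S -> (forall w, sorted <=%O w -> S (word w)) -> forall u, S u.
Proof.
move=> subS /(uea_word_mem subS) Sword u.
rewrite -[u]mul1r -(uea_word_nil br e).
move: u [::]; apply: palg_ind => [|w|x u Su w].
- split=> [w|a u v Su Sv w]; first by rewrite mulr0; apply: submodule0.
  by rewrite mulr_linearr; apply: subS.2.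
- by rewrite mulr1.
move: x; apply: (basis_ind e_basis) => [|i] /=.
  apply: (submodule_preimage _ subS).
  exact: (linearP (word w \*o (u \o* gen))).
by have := Su (rcons w i); rewrite -cats1 uea_word_cat uea_word1 -mulrA.
Qed.

Section Extension.
Variable C : lmodType k.

(* U acts on the maps on words satisfying [straightened] by appending letters;
   the extension of such a map is the value of this action at the empty word. *)
Let append (x : g) (s : seq I -> C) (w : seq I) : C :=
  lin_ext e_basis (fun i => s (rcons w i)) x.

Let straight : set (seq I -> C) :=
  [set s | forall a x y b, straightened br e_basis s a x y b].

Let straight_submodule : submodule straight.
Proof.
split=> [a x y b|c s t sP tP a x y b]; rewrite /straightened /slot.
  by rewrite (lin_ext0 e_basis) addr0.
by rewrite !fctE sP tP lin_extD lin_extZ scalerDr addrACA.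
Qed.

Let append_straight x s : straight s -> straight (append x s).
Proof.
move=> sP a y z b; rewrite /straightened /slot /append lin_ext_exchange.
rewrite -lin_extD; apply: eq_lin_ext => i.
rewrite !rcons_cat /= (sP a y z (rcons b i)).
by congr (_ + _); apply: eq_lin_ext => c; rewrite rcons_cat.
Qed.

Let append_rels t u s : uea_rels br t u -> straight s ->
  uea_term_act br append t s = uea_term_act br append u s.
Proof.
case=> [x y|a x|x y] sP; apply/funext => w; rewrite /= !fctE /append.
- by rewrite linearD.
- by rewrite linearZ.
rewrite scaleN1r [X in _ - X]lin_ext_exchange.
move: x; apply: (eq_on_basis e_basis) => [c v v'|c v v'|i].
- by rewrite (lie_linearl brL) linearP.
- by rewrite !linearP addrACA -scalerDr.
rewrite !lin_ext_basis; move: y.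
apply: (eq_on_basis e_basis) => [c v v'|c v v'|j].
- by rewrite (lie_linearr brL) linearP.
- by rewrite !linearP addrACA -scalerDr.
rewrite !lin_ext_basis -!cats1 -!catA /= [s _](sP w i j [::]) addrC addKr.
by apply: eq_lin_ext => l; rewrite cats1.
Qed.

Let append_module : uea_module br straight append.
Proof.
split; [exact: straight_submodule|exact: append_straight| |exact: append_rels].
move=> x c s t _ _; apply/funext => w.
by rewrite !fctE /append lin_extD lin_extZ.
Qed.

Let append_word w s v :
  straight s -> uea_act br append (word w) s v = s (v ++ w).
Proof.
elim/last_ind: w s v => [|w i IH] s v sP.
  by rewrite uea_word_nil (palg_act1 append_module) // cats0.
rewrite -cats1 uea_word_cat uea_word1 (palg_actM append_module) // IH.
  by rewrite (palg_act_gen append_module) // /append lin_ext_basis -cats1 catA.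
exact: (palg_act_closed append_module).
Qed.

Lemma pbw_extension (tau : seq I -> C) : exists f : {linear U -> C},
  forall w, sorted <=%O w -> f (word w) = tau w.
Proof.
pose s := straighten br e_basis tau.
have sP : straight s by move=> a x y b; apply: straighten_straightened.
pose f (u : U) := uea_act br append u s [::].
have f_linear : linear f.
  by move=> a u v; rewrite /f (palg_act_linear append_module).
exists (linear_pack f_linear) => w w_sorted.
by rewrite [LHS]append_word // [LHS]straighten_sorted.
Qed.

End Extension.

Theorem pbw_basis : is_basis (fun w : {w | sorted <=%O w} => word (val w)).
Proof.
split=> [u S [subS Sw]|C F].
  by apply: uea_word_ind u => // w w_sorted; apply: Sw; exists (Sub w w_sorted).
have [f fE] := pbw_extension
  (fun w => if insub w is Some w' then F w' else 0).
by exists f => w; rewrite fE ?valK //; apply: valP.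
Qed.

Definition pbw_ext (C : lmodType k) (tau : seq I -> C) : {linear U -> C} :=
  lin_ext pbw_basis (tau \o val).

Lemma pbw_extE (C : lmodType k) (tau : seq I -> C) w :
  sorted <=%O w -> pbw_ext tau (word w) = tau w.
Proof. by move=> w_sorted; apply: (lin_ext_basis _ _ (Sub w w_sorted)). Qed.

End PBWBasis.

Lemma uea_gen_inj (k : fieldType) (g : lmodType k) (br : g -> g -> g) :
  lie_algebra br -> injective (uea_gen br).
Proof.
move=> brL; have [d [I [e e_basis]]] := exists_ordered_basis g.
pose f := pbw_ext brL e_basis (fun w => if w is i :: _ then e i else 0).
suff f_gen : cancel (uea_gen br) f by apply: can_inj f_gen.
apply: (eq_on_basis e_basis (f := f \o uea_gen br) (h := idfun)) => [||i].
- exact: linearP.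
- exact: linearP.
- by rewrite /= -(uea_word1 br e) pbw_extE.
Qed.

(** * Primitive elements *)

Section ModularBinomials.
Variable p : nat.

Lemma prime_dvd_bin_pfactor e n i :
  prime p -> (p ^ e %| n)%N -> (0 < i < p ^ e)%N -> (p %| 'C(n, i))%N.
Proof.
case: i => // i p_pr pe_n /andP[_ i_lt]; apply: contraLR i_lt => p_bin.
rewrite -leqNgt dvdn_leq //.
have pe_bin : coprime (p ^ e) 'C(n, i.+1) by rewrite coprimeXl ?prime_coprime.
by rewrite -(Gauss_dvdl _ pe_bin) -mul_bin_diag dvdn_mulr.
Qed.

Lemma bin_pred_pfactor (B : nzRingType) e n j :
    p \in [pchar B] -> (p ^ e %| n)%N -> (0 < n)%N -> (j < p ^ e)%N ->
  'C(n.-1, j)%:R = (-1) ^+ j :> B.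
Proof.
move=> charBp pe_n n_gt0; elim: j => [|j IH] jp; first by rewrite bin0.
have : 'C(n, j.+1)%:R == 0 :> B.
  rewrite -(dvdn_pcharf charBp) (@prime_dvd_bin_pfactor e) //.
  exact: pcharf_prime charBp.
by rewrite -{1}(prednK n_gt0) binS natrD IH ?(ltnW jp) // addr_eq0 exprS mulN1r
  => /eqP.
Qed.

Lemma bin_ppart_neq0 (F : fieldType) n :
  p \in [pchar F] -> (0 < n)%N -> 'C(n, p ^ logn p n)%:R != 0 :> F.
Proof.
move=> charFp n_gt0; have p_pr := pcharf_prime charFp.
have [m pm nE] := pfactor_coprime p_pr n_gt0.
set q := (p ^ logn p n)%N in nE *.
have q_gt0 : (0 < q)%N by rewrite expn_gt0 prime_gt0.
have -> : 'C(n, q) = (m * 'C(n.-1, q.-1))%N.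
  apply/eqP; rewrite -(eqn_pmul2l q_gt0); have := mul_bin_diag n q.-1.
  by rewrite prednK // => <-; rewrite mulnA {1}nE [(m * q)%N]mulnC.
rewrite natrM (@bin_pred_pfactor _ (logn p n)) ?pfactor_dvdnn //; last first.
  by rewrite -/q prednK.
by rewrite mulf_neq0 ?signr_eq0 // -(dvdn_pcharf charFp) -prime_coprime.
Qed.

End ModularBinomials.

Section TensorExtension.
Variables (k : fieldType) (P Q : presentation k) (C : lmodType k).
Notation A := (palg P).
Notation B := (palg Q).
Notation T := (tensor P Q).

Let bilinear : set (A * B -> C) :=
  [set b | (forall v, linear (fun u => b (u, v))) /\
           (forall u, linear (fun v => b (u, v)))].

(* T acts on the bilinear maps by right translations; the extension of a
   bilinear map is the value of this action at [(1, 1)]. *)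
Let translate (x : A * B) (b : A * B -> C) (y : A * B) : C :=
  b (y.1 * x.1, y.2 * x.2).

Let bilinear_submodule : submodule bilinear.
Proof.
split=> [|c b b' [bl br] [bl' br']].
  by split=> [v|u] a x y; rewrite -[RHS]/(a *: (0 : C) + 0) scaler0 addr0.
split=> [v|u] a x y; rewrite !fctE ?bl ?bl' ?br ?br'.
  by rewrite !scalerDr addrACA !scalerA mulrC.
by rewrite !scalerDr addrACA !scalerA mulrC.
Qed.

Let bilinear_translate x b : bilinear b -> bilinear (translate x b).
Proof.
move=> [bl br]; split=> [v|u] a y z; rewrite /translate /=.
  by rewrite mulr_linearl bl.
by rewrite mulr_linearl br.
Qed.

Let translate_rels t u b : tensor_rels t u -> bilinear b ->
  term_act (P := tensor_presentation P Q) translate t b =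
  term_act (P := tensor_presentation P Q) translate u b.
Proof.
move=> tu [bl br]; apply/funext => -[y z].
have blD v x x' : b (x + x', v) = b (x, v) + b (x', v).
  by have := bl v 1 x x'; rewrite !scale1r.
have brD v x x' : b (v, x + x') = b (v, x) + b (v, x').
  by have := br v 1 x x'; rewrite !scale1r.
case: tu => [a a' c|a c c'|a c c'|a c c'||a c a' c'] /=;
  rewrite ?fctE /translate /=.
- by rewrite mulrDr blD.
- by rewrite mulrDr brD.
- by rewrite -scalerAr (GRing.scalable_linear (bl _)).
- by rewrite -scalerAr (GRing.scalable_linear (br _)).
- by rewrite !mulr1 scale1r.
- by rewrite !mulrA.
Qed.

Lemma tensor_extension (b : A -> B -> C) :
    (forall v, linear (b^~ v)) -> (forall u, linear (b u)) ->
  exists F : {linear T -> C}, forall u v, F (tens u v) = b u v.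
Proof.
move=> bl br; pose b' (y : A * B) := b y.1 y.2.
have b'P : bilinear b' by [].
have moduleP :
    presented_module (P := tensor_presentation P Q) bilinear translate.
  by split; [exact: bilinear_submodule|exact: bilinear_translate| |
    exact: translate_rels].
pose f (t : T) := palg_act (P := tensor_presentation P Q) translate t b' (1, 1).
have f_linear : linear f.
  by move=> a u v; rewrite /f (palg_act_linear moduleP).
exists (linear_pack f_linear) => u v.
rewrite -[LHS]/(f (tens u v)) /f (palg_act_gen moduleP) //.
by rewrite /translate /b' /= !mul1r.
Qed.

End TensorExtension.

Section Tensors.
Variables (k : fieldType) (P Q : presentation k).
Implicit Types (a : palg P) (b : palg Q).

Lemma tens_linearl b : linear (fun a => tens a b).
Proof. by move=> c a a'; rewrite tensDl tensZl. Qed.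

Lemma tens_linearr a : linear (fun b => tens a b).
Proof. by move=> c b b'; rewrite tensDr tensZr. Qed.

Lemma tensX a b n : tens a b ^+ n = tens (a ^+ n) (b ^+ n).
Proof.
by elim: n => [|n IH]; rewrite ?expr0 ?tens11 // !exprS IH -tensM.
Qed.

End Tensors.

Section Splittings.
Variable I : eqType.
Implicit Types (i : I) (w A B : seq I) (s : seq I * seq I).

Fixpoint splittings w : seq (seq I * seq I) :=
  if w is i :: w' then
    [seq (i :: s.1, s.2) | s <- splittings w'] ++
    [seq (s.1, i :: s.2) | s <- splittings w']
  else [:: ([::], [::])].

Lemma splittingsP w s : s \in splittings w ->
  [/\ subseq s.1 w, subseq s.2 w & perm_eq (s.1 ++ s.2) w].
Proof.
elim: w s => [|i w IH] s; first by rewrite inE => /eqP->.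
have subw t : subseq t w -> subseq t (i :: w).
  by move=> tw; apply: subseq_trans tw (subseq_cons _ _).
rewrite mem_cat => /orP[]/mapP[t /IH[t1 t2 pt] ->]; split.
- by rewrite /= eqxx.
- exact: subw.
- by rewrite /= perm_cons.
- exact: subw.
- by rewrite /= eqxx.
- by rewrite -cat1s perm_catCA /= perm_cons.
Qed.

Lemma count_splittings_cons i w A B :
  count_mem (A, B) (splittings (i :: w)) =
  ((if A is x :: A' then (x == i) * count_mem (A', B) (splittings w) else 0) +
   (if B is x :: B' then (x == i) * count_mem (A, B') (splittings w) else 0))%N.
Proof.
rewrite /= count_cat !count_map; congr (_ + _)%N.
- case: A => [|x A].
    by rewrite -(count_pred0 (splittings w)); apply: eq_count.
  case: (eqVneq x i) => [->|/negPf xi]; rewrite ?mul1n ?mul0n.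
    by apply: eq_count => s; rewrite /= !xpair_eqE eqseq_cons eqxx; case: s.
  rewrite -(count_pred0 (splittings w)); apply: eq_count => s /=.
  by rewrite xpair_eqE eqseq_cons eq_sym xi.
- case: B => [|x B].
    rewrite -(count_pred0 (splittings w)); apply: eq_count => s /=.
    by rewrite xpair_eqE andbF.
  case: (eqVneq x i) => [->|/negPf xi]; rewrite ?mul1n ?mul0n.
    by apply: eq_count => s; rewrite /= !xpair_eqE eqseq_cons eqxx; case: s.
  rewrite -(count_pred0 (splittings w)); apply: eq_count => s /=.
  by rewrite xpair_eqE eqseq_cons [i == x]eq_sym xi andbF.
Qed.

Lemma count_splittings_filter (a : pred I) w :
  count_mem (filter a w, filter (predC a) w) (splittings w) = 1%N.
Proof.
elim: w => // i w IH; rewrite count_splittings_cons /=.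
have head_filter c x A : filter c w = x :: A -> c x.
  by move=> cE; have := mem_head x A; rewrite -cE mem_filter => /andP[].
have [ai|ai] /= := boolP (a i); rewrite eqxx IH mul1n.
  case E: (filter _ w) => [//|x B]; have := head_filter _ _ _ E.
  by case: eqVneq => // -> /=; rewrite ai.
case E: (filter _ w) => [//|x B]; have := head_filter _ _ _ E.
by case: eqVneq => // -> /=; rewrite (negPf ai).
Qed.

Lemma count_splittings_nseq i a b :
  count_mem (nseq a i, nseq b i) (splittings (nseq (a + b) i)) = 'C(a + b, a).
Proof.
have [n] := ubnP (a + b); elim: n a b => // n IH [|a] [|b] abn.
- by [].
- rewrite count_splittings_cons /= eqxx mul1n add0n.
  by rewrite (IH 0%N b) ?bin0 // ltnW.
- rewrite addn0 count_splittings_cons /= eqxx mul1n addn0.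
  by have := IH a 0%N; rewrite addn0 => ->; rewrite ?binn //; lia.
transitivity
    (count_mem (nseq a i, nseq b.+1 i) (splittings (nseq (a + b.+1) i)) +
     count_mem (nseq a.+1 i, nseq b i) (splittings (nseq (a.+1 + b) i)))%N.
  rewrite -[nseq (_ + _) i]/(i :: nseq (a + b.+1) i) count_splittings_cons.
  by rewrite [LHS]/= eqxx !mul1n addnS addSn.
by rewrite !IH ?addSn ?addnS ?binS 1?addnC //; lia.
Qed.

Variable k : fieldType.

Lemma exists_splitting p w :
    p \in [pchar k] -> w != [::] -> (forall i n, w != nseq (p ^ n) i) ->
  exists A B, [/\ A != [::], B != [::], perm_eq (A ++ B) w &
    (count_mem (A, B) (splittings w))%:R != 0 :> k].
Proof.
move=> charkp; case: w => // i w _ w_bad.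
have [w_i|w_i] := boolP (all (pred1 i) w); last first.
  exists (filter (pred1 i) (i :: w)), (filter (predC (pred1 i)) (i :: w)).
  split; first by rewrite /= eqxx.
  - by rewrite -has_filter /= eqxx /= has_predC.
  - by rewrite perm_filterC.
  - by rewrite count_splittings_filter oner_neq0.
have wE : i :: w = nseq (size w).+1 i by congr (_ :: _); apply/all_pred1P.
set n := (size w).+1 in wE; have n_gt0 : (0 < n)%N by [].
set q := (p ^ logn p n)%N.
have q_dvd : (q %| n)%N by apply: pfactor_dvdnn.
have q_gt0 : (0 < q)%N by rewrite (dvdn_gt0 _ q_dvd).
have qn : (q < n)%N.
  rewrite ltn_neqAle dvdn_leq // andbT; apply/eqP => qn.
  by have := w_bad i (logn p n); rewrite wE -/q qn eqxx.
have nE : n = (q + (n - q))%N by rewrite subnKC // ltnW.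
exists (nseq q i), (nseq (n - q) i); split.
- by rewrite -size_eq0 size_nseq -lt0n.
- by rewrite -size_eq0 size_nseq subn_eq0 -ltnNge.
- by rewrite -nseqD -nE wE.
- by rewrite wE [in splittings _]nE count_splittings_nseq -nE bin_ppart_neq0.
Qed.

End Splittings.

Section Comultiplication.
Variables (k : fieldType) (g : lmodType k) (br : g -> g -> g).
Notation U := (uea br).
Notation gen := (uea_gen br).
Notation UU := (tensor (uea_presentation br) (uea_presentation br)).

Fact comult_linear : linear (@comult k g br).
Proof.
by move=> a u v; rewrite /comult pliftD ?pliftZ //; apply: comult_genP.
Qed.

Fact comult_monoid_morphism : monoid_morphism (@comult k g br).
Proof. split=> [|u v]; [apply: plift1 | apply: pliftM]; exact: comult_genP. Qed.

HB.instance Definition _ :=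
  GRing.isLinear.Build k U UU *:%R (@comult k g br) comult_linear.
HB.instance Definition _ :=
  GRing.isMonoidMorphism.Build U UU (@comult k g br) comult_monoid_morphism.

Lemma comult_uea_gen x : comult (gen x) = tens (gen x) 1 + tens 1 (gen x).
Proof. exact/plift_gen/comult_genP. Qed.

Lemma primitives_submodule : submodule (primitives br).
Proof.
apply: (submodule_eq (f := @comult k g br)) => [|a u v]; first exact: linearP.
by rewrite tens_linearl tens_linearr scalerDr addrACA.
Qed.

Lemma primitives_gen x : primitives br (gen x).
Proof. exact: comult_uea_gen. Qed.

Lemma primitivesX p u :
  p \in [pchar k] -> primitives br u -> primitives br (u ^+ p).
Proof.
move=> charkp uP; rewrite /primitives /= rmorphXn /= uP.
have charT : p \in [pchar UU] by rewrite pchar_lalg.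
rewrite -(pFrobenius_autE charT) pFrobenius_autD_comm.
  by rewrite !pFrobenius_autE !tensX expr1n.
by rewrite /GRing.comm -!tensM !mulr1 !mul1r.
Qed.

Lemma comult_word (I : eqType) (e : I -> g) w : comult (uea_word br e w) =
  \sum_(s <- splittings w) tens (uea_word br e s.1) (uea_word br e s.2).
Proof.
elim: w => [|i w IH].
  by rewrite big_seq1 /= !uea_word_nil tens11 rmorph1.
rewrite uea_word_cons rmorphM /= IH comult_uea_gen mulrDl !mulr_sumr.
rewrite big_cat !big_map /=.
by congr (_ + _); apply: eq_bigr => s _; rewrite uea_word_cons -tensM mul1r.
Qed.

End Comultiplication.

Section PrimitiveCoordinates.
Variables (k : fieldType) (g : lmodType k) (br : g -> g -> g).
Hypothesis brL : lie_algebra br.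
Variables (d : Order.disp_t) (I : orderType d) (e : I -> g).
Hypothesis e_basis : is_basis e.
Notation U := (uea br).
Notation gen := (uea_gen br).
Notation UU := (tensor (uea_presentation br) (uea_presentation br)).
Notation word := (uea_word br e).
Implicit Types (A B M : seq I).

Definition word_coord M : {linear U -> k^o} :=
  pbw_ext brL e_basis (fun w => (w == M)%:R).

Lemma word_coordE M w :
  sorted <=%O w -> word_coord M (word w) = (w == M)%:R.
Proof. exact: pbw_extE. Qed.

Lemma word_coord1 M : word_coord M 1 = (M == [::])%:R.
Proof. by rewrite -(uea_word_nil br e) word_coordE // eq_sym. Qed.

(* The coordinate functions at the sorted words multiply, in the algebra dual to
   U(g), as divided powers. *)
Lemma word_coord_comult A B M :
    sorted <=%O M -> perm_eq (A ++ B) M ->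
    forall F : {linear UU -> k^o},
    (forall u v, F (tens u v) = word_coord A u * word_coord B v) ->
  forall u, F (comult u) =
    (count_mem (A, B) (splittings M))%:R * word_coord M u.
Proof.
move=> M_sorted ABM F FE; apply: (uea_word_ind e_basis) => [|w w_sorted].
  apply: (submodule_eq (f := F \o @comult k g br)); first exact: linearP.
  by move=> a u v; rewrite linearP mulrDr [_ * (_ *: _)]mulrCA.
rewrite /= comult_word linear_sum.
have FsE s : s \in splittings w ->
    F (tens (word s.1) (word s.2)) = (s == (A, B))%:R.
  case: s => C D /splittingsP[/= Cw Dw _]; rewrite FE xpair_eqE.
  by rewrite !word_coordE ?(subseq_sorted le_trans _ w_sorted) // -natrM mulnb.
rewrite big_seq (eq_bigr _ FsE) -big_seq -natr_sum word_coordE // -natrM.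
congr (_%:R); rewrite -sum1_count [in RHS]big_mkcond.
have [->|wM] := eqVneq w M; first by rewrite muln1.
rewrite muln0 big_seq big1 // => s /splittingsP[_ _ sw].
case: eqP sw => // -> /= ABw; case/eqP: wM.
by apply: (sorted_eq le_trans le_anti); rewrite // -(permPr ABM) perm_sym.
Qed.

Lemma word_coord_primitive A B M u :
    sorted <=%O M -> perm_eq (A ++ B) M -> primitives br u ->
  word_coord A u * word_coord B 1 + word_coord A 1 * word_coord B u =
  (count_mem (A, B) (splittings M))%:R * word_coord M u.
Proof.
move=> M_sorted ABM uP.
have [|a c v v'|F FE] := tensor_extension
  (b := fun u v => word_coord A u *: word_coord B v : k^o).
- by move=> v a w w'; rewrite linearP scalerDl scalerA.
- by rewrite linearP scalerDr !scalerA mulrC.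
by rewrite -(word_coord_comult M_sorted ABM FE) uP linearD !FE.
Qed.

Lemma word_coord_primitive_eq0 p M u : p \in [pchar k] ->
    sorted <=%O M -> (forall i n, M != nseq (p ^ n) i) -> primitives br u ->
  word_coord M u = 0.
Proof.
move=> charkp M_sorted M_bad uP.
have [M0|M0] := eqVneq M [::].
  have := word_coord_primitive (A := [::]) (B := [::]) M_sorted _ uP.
  rewrite M0 !word_coord1 eqxx mulr1 !mul1r => /(_ isT)/eqP.
  by rewrite -subr_eq0 addrK => /eqP.
have [A [B [A0 B0 ABM N0]]] := exists_splitting charkp M0 M_bad.
have := word_coord_primitive M_sorted ABM uP.
rewrite !word_coord1 (negPf A0) (negPf B0) mulr0 mul0r addr0 => /esym/eqP.
by rewrite mulf_eq0 (negPf N0) => /eqP.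
Qed.

Lemma primitives_ind p (S : set U) : p \in [pchar k] -> submodule S ->
  (forall i n, S (gen (e i) ^+ (p ^ n))) -> forall u, primitives br u -> S u.
Proof.
move=> charkp subS Se u uP.
apply: (basis_coord_ind (e_basis := pbw_basis brL e_basis)) => // w.
have -> : basis_coord (pbw_basis brL e_basis) w u = word_coord (val w) u.
  by apply: eq_lin_ext => v /=; rewrite val_eqE.
have [[i [n ->]] _|w_bad] := pselect (exists i n, val w = nseq (p ^ n) i).
  by rewrite uea_word_nseq.
rewrite (word_coord_primitive_eq0 charkp (valP w)) ?eqxx // => i n.
by apply/eqP => wE; apply: w_bad; exists i, n.
Qed.

End PrimitiveCoordinates.

Section PowerSpan.
Variables (k : fieldType) (p : nat).
Variables (g : lmodType k) (br : g -> g -> g).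
Notation gen := (uea_gen br).

Lemma gp_set_submodule : submodule (gp_set p br).
Proof.
have [S0 SP] := gp_submod_closed p br.
split=> [|a u v Su Sv]; first exact/asboolP.
by apply/asboolP/SP; apply/asboolP.
Qed.

Lemma gp_set_genX x n : gp_set p br (gen x ^+ (p ^ n)).
Proof.
exists 1%N, (fun=> 1), (fun=> gen x ^+ (p ^ n)).
by split=> [_|]; [exists x, n | rewrite big_ord1 scale1r].
Qed.

Lemma gp_set_gen x : gp_set p br (gen x).
Proof. exact: (gp_set_genX x 0). Qed.

Lemma gp_set_ind (S : set (uea br)) : submodule S ->
  (forall x n, S (gen x ^+ (p ^ n))) -> forall u, gp_set p br u -> S u.
Proof.
move=> subS SX u [n [a [e [eE ->]]]]; apply: (submodule_sum subS) => j _ _.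
by apply: submoduleZ => //; have [x [m ->]] := eE j.
Qed.

Hypothesis charkp : p \in [pchar k].

Lemma gp_set_primitives u : gp_set p br u -> primitives br u.
Proof.
apply: gp_set_ind => [|x n]; first exact: primitives_submodule.
elim: n => [|n IH]; first exact: primitives_gen.
by rewrite expnSr exprM; apply: primitivesX.
Qed.

Hypothesis brL : lie_algebra br.

Theorem gp_set_eq_primitives : gp_set p br = primitives br.
Proof.
apply/seteqP; split=> u; first exact: gp_set_primitives.
have [d [I [e e_basis]]] := exists_ordered_basis g.
apply: (primitives_ind brL e_basis charkp) => [|i n].
  exact: gp_set_submodule.
exact: gp_set_genX.
Qed.

Lemma gp_set_basis_ind d (I : orderType d) (e : I -> g) (S : set (uea br)) :
    is_basis e -> submodule S -> (forall i n, S (gen (e i) ^+ (p ^ n))) ->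
  forall u, gp_set p br u -> S u.
Proof.
move=> e_basis subS Se u; rewrite gp_set_eq_primitives.
exact: (primitives_ind brL e_basis charkp).
Qed.

Lemma gp_setX u : gp_set p br u -> gp_set p br (u ^+ p).
Proof. by rewrite gp_set_eq_primitives; apply: primitivesX. Qed.

End PowerSpan.

(** * Extension of a Rota-Baxter operator *)

Section DescendentBracket.
Variables (k : fieldType) (g : lmodType k) (br : g -> g -> g) (R : g -> g).

Definition rb_bracket x y := br (R x) y + br x (R y) + br x y.

Definition rb_shift x := R x + x.

Hypothesis gRB : rb_lie_algebra 1 br R.

Let brL : lie_algebra br := gRB.1.

Lemma rb_linear : linear R. Proof. by case: gRB => _ []. Qed.

HB.instance Definition _ := GRing.isLinear.Build k g g *:%R R rb_linear.

Lemma rb_morph x y : R (rb_bracket x y) = br (R x) (R y).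
Proof. by case: gRB => _ [_ ->]; rewrite scale1r !linearD. Qed.

Lemma rb_shift_linear : linear rb_shift.
Proof. by move=> a x y; rewrite /rb_shift linearP scalerDr addrACA. Qed.

Lemma rb_shift_morph x y :
  rb_shift (rb_bracket x y) = br (rb_shift x) (rb_shift y).
Proof.
rewrite /rb_shift rb_morph !(lieDl brL) !(lieDr brL) /rb_bracket -!addrA.
by congr (_ + _); rewrite addrA.
Qed.

End DescendentBracket.

Section Transport.
Variables (k : fieldType) (g : lmodType k) (br : g -> g -> g) (R : g -> g).
Hypothesis gRB : rb_lie_algebra 1 br R.
Notation U := (uea br).
Notation UR := (uea (rb_bracket br R)).
Notation gen := (uea_gen br).
Notation genR := (uea_gen (rb_bracket br R)).
Notation shift := (rb_shift R).

Let brL : lie_algebra br := gRB.1.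

HB.instance Definition _ := GRing.isLinear.Build k g g *:%R R (rb_linear gRB).
HB.instance Definition _ :=
  GRing.isLinear.Build k g g *:%R shift (rb_shift_linear gRB).

Let derive (t : g) (F : g -> UR) (x : g) : UR :=
  genR t * F x + F (br x (shift t)).

Let linear_maps : set (g -> UR) := [set F | linear F].

Let linear_maps_submodule : submodule linear_maps.
Proof.
split=> [a x y|c F G F_linear G_linear a x y].
  by rewrite [LHS]/= scaler0 addr0.
by rewrite !fctE F_linear G_linear !scalerDr addrACA !scalerA mulrC.
Qed.

Let derive_linear t F : linear F -> linear (derive t F).
Proof.
move=> F_linear a x y; rewrite /derive F_linear (lie_linearl brL) F_linear.
by rewrite mulr_linearr scalerDr addrACA.
Qed.

Let derive_rels t u (F : {linear g -> UR}) : uea_rels (rb_bracket br R) t u ->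
  uea_term_act (rb_bracket br R) derive t F =
  uea_term_act (rb_bracket br R) derive u F.
Proof.
case=> [x y|a x|x y]; apply/funext => z; rewrite /= !fctE /derive.
- by rewrite linearD mulrDl linearD (lieDr brL) linearD addrACA.
- by rewrite linearZ -scalerAl linearZ (lieZr brL) linearZ scalerDr.
rewrite scaleN1r (rb_shift_morph gRB) uea_gen_br /commutator (lie_jacobi brL).
rewrite linearD [br (shift x) _](lie_anti brL) linearN.
rewrite !mulrDr mulrBl !mulrA !opprD !addrA.
by rewrite [RHS](ACl (1*5*4*8*(2*7)*(3*6))) /= !subrr !addr0.
Qed.

Let derive_module : uea_module (rb_bracket br R) linear_maps derive.
Proof.
split; [exact: linear_maps_submodule|exact: derive_linear| |].
  move=> t a F G _ _; apply/funext => x.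
  by rewrite /derive !fctE mulr_linearr scalerDr addrACA.
by move=> t u F tu F_linear; apply: (derive_rels (linear_pack F_linear) tu).
Qed.

(* The transport to UR of the left multiplication by x in U, along the linear
   isomorphism from UR to U sending a product [t1 .. tn] to
   [(t1 + ad (R t1)) .. (tn + ad (R tn)) 1]. *)
Definition transport (x : g) (v : UR) : UR :=
  uea_act (rb_bracket br R) derive v genR x.

Let genR_linear : linear_maps genR := @uea_gen_linear k g _.

Lemma transport_linearl v : linear (transport^~ v).
Proof. exact: (palg_act_closed derive_module v genR_linear). Qed.

Lemma transport_linearr x : linear (transport x).
Proof. by move=> a u v; rewrite /transport (palg_act_linear derive_module). Qed.

HB.instance Definition _ x :=
  GRing.isLinear.Build k UR UR *:%R (transport x) (transport_linearr x).

Lemma transportD x y v : transport (x + y) v = transport x v + transport y v.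
Proof. by have := transport_linearl v 1 x y; rewrite !scale1r. Qed.

Lemma transport1 x : transport x 1 = genR x.
Proof. by rewrite /transport (palg_act1 derive_module). Qed.

Lemma transportM x t v : transport x (genR t * v) =
  genR t * transport x v + transport (br x (shift t)) v.
Proof.
rewrite /transport (palg_actM derive_module) //.
rewrite (palg_act_gen derive_module) //.
exact: (palg_act_closed derive_module).
Qed.

Lemma transport_gen x t :
  transport x (genR t) = genR t * genR x + genR (br x (shift t)).
Proof. by rewrite -[in LHS](mulr1 (genR t)) transportM !transport1. Qed.

Lemma transport_br x y v : transport (br x y) v =
  transport x (transport y v) - transport y (transport x v).
Proof.
move: v x y; apply: palg_ind => [|x y|t v IH x y].
- split=> [x y|a u v IHu IHv x y]; first by rewrite !linear0 addr0.
  by rewrite !linearP /= IHu IHv [RHS]addrACA -scalerDr.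
- rewrite !transport1 !transport_gen opprD addrACA -[_ * _ - _]opprB.
  rewrite -/(commutator (genR x) (genR y)) -uea_gen_br.
  rewrite -!linearN -!linearD; congr genR.
  rewrite /rb_bracket /rb_shift [br y _](lie_anti brL) opprK.
  rewrite (lieDl brL) (lieDr brL) !opprD !addrA.
  by rewrite [RHS](ACl ((1*6)*(2*4)*(3*5)*7)) /= !addNr !add0r.
rewrite -[pgen t]/(genR t) !transportM !linearD /= !transportM.
have -> : br (br x y) (shift t) =
    br x (br y (shift t)) - br y (br x (shift t)).
  by rewrite (lie_jacobi brL x) addrK.
move: (br x (shift t)) (br y (shift t)) => X Y.
rewrite (GRing.zmod_morphism_linear (transport_linearl v)) !IH mulrBr !opprD.
by rewrite !opprK !addrA [LHS](ACl (1*6*3*2*4*5)).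
Qed.

Let transport_module : uea_module br [set: UR] transport.
Proof.
split=> // [x a u v _ _|t u v tu _]; first exact: linearP.
case: tu => [x y|a x|x y] /=.
- exact: transportD.
- exact: (GRing.scalable_linear (transport_linearl v)).
- by rewrite scaleN1r transport_br.
Qed.

Definition to_descendent (u : U) : UR := uea_act br transport u 1.

Lemma to_descendent_linear : linear to_descendent.
Proof. exact: (palg_act_linear transport_module). Qed.

HB.instance Definition _ :=
  GRing.isLinear.Build k U UR *:%R to_descendent to_descendent_linear.

Lemma to_descendent1 : to_descendent 1 = 1.
Proof. exact: (palg_act1 transport_module). Qed.

Lemma to_descendentM x u :
  to_descendent (gen x * u) = transport x (to_descendent u).
Proof.
rewrite /to_descendent (palg_actM transport_module) //.
exact: (palg_act_gen transport_module).
Qed.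

Lemma to_descendent_gen x : to_descendent (gen x) = genR x.
Proof. by rewrite -[gen x]mulr1 to_descendentM to_descendent1 transport1. Qed.

Lemma to_descendent_mulr x u : to_descendent (u * gen (R x)) =
  transport (shift x) (to_descendent u) - genR x * to_descendent u.
Proof.
move: u; apply: palg_ind => [||y u /= IH].
- apply: submodule_eq => a u v; first by rewrite mulr_linearl linearP.
  by rewrite !linearP mulr_linearr scalerBr opprD addrACA.
- rewrite /= mul1r to_descendent_gen to_descendent1 transport1 mulr1.
  by rewrite -linearB /rb_shift addrK.
rewrite -mulrA -[pgen y]/(gen y) !to_descendentM IH linearB /= transportM.
rewrite transport_br !opprD opprK !addrA [LHS](ACl ((1*3)*4*2)) /= subrr.
by rewrite add0r.
Qed.

Lemma to_descendent_commutator x u :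
  to_descendent (gen x * u + commutator (gen (R x)) u) =
  genR x * to_descendent u.
Proof.
rewrite linearD linearB /= !to_descendentM to_descendent_mulr transportD.
by rewrite !opprD opprK !addrA [LHS](ACl ((1*4)*(2*3)*5)) /= !subrr !add0r.
Qed.

End Transport.

Section UEAMap.
Variables (k : fieldType) (g h : lmodType k).
Variables (brg : g -> g -> g) (brh : h -> h -> h) (phi : g -> h).

Definition uea_map : uea brg -> uea brh :=
  plift (P := uea_presentation brg) (fun x => uea_gen brh (phi x)).

Hypothesis phi_linear : linear phi.
Hypothesis phi_br : forall x y, phi (brg x y) = brh (phi x) (phi y).

HB.instance Definition _ := GRing.isLinear.Build k g h *:%R phi phi_linear.

Let uea_map_rels t u : uea_rels brg t u ->
  teval (fun x => uea_gen brh (phi x)) t =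
  teval (fun x => uea_gen brh (phi x)) u.
Proof.
apply: uea_relsP => [x y|a x|x y]; first by rewrite !linearD.
  by rewrite !linearZ.
by rewrite phi_br uea_gen_br.
Qed.

Lemma uea_map_linear : linear uea_map.
Proof.
by move=> a u v; rewrite /uea_map pliftD ?pliftZ //; apply: uea_map_rels.
Qed.

Lemma uea_map1 : uea_map 1 = 1.
Proof. exact/plift1/uea_map_rels. Qed.

Lemma uea_mapM u v : uea_map (u * v) = uea_map u * uea_map v.
Proof. exact/pliftM/uea_map_rels. Qed.

Lemma uea_map_gen x : uea_map (uea_gen brg x) = uea_gen brh (phi x).
Proof. exact/plift_gen/uea_map_rels. Qed.

End UEAMap.

Section RotaBaxterExtension.
Variables (k : fieldType) (g : lmodType k) (br : g -> g -> g) (R : g -> g).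
Hypothesis gRB : rb_lie_algebra 1 br R.
Notation U := (uea br).
Notation gen := (uea_gen br).

Lemma rb_extension_exists : exists RU, rb_extension br R RU.
Proof.
have R_linear := rb_linear gRB; have R_morph := rb_morph gRB.
pose Rhat : uea (rb_bracket br R) -> U := uea_map br R.
have Rhat_linear : linear Rhat by apply: uea_map_linear.
pose RU u := Rhat (to_descendent R u).
have RU_linear : linear RU.
  by move=> a u v; rewrite /RU (to_descendent_linear gRB) Rhat_linear.
have RU_gen x : RU (gen x) = gen (R x).
  by rewrite /RU (to_descendent_gen gRB) [LHS]uea_map_gen.
have RU_recursion x u :
    RU (gen x * u + commutator (gen (R x)) u) = gen (R x) * RU u.
  rewrite /RU (to_descendent_commutator gRB) [LHS]uea_mapM //.
  by rewrite uea_map_gen.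
exists RU; split=> // [|x u].
  by rewrite /RU (to_descendent1 gRB) [LHS]uea_map1.
rewrite RU_gen -RU_recursion.
by rewrite -(GRing.zmod_morphism_linear RU_linear) addrK.
Qed.

Lemma commutator_genM x y (u : U) : commutator (gen x) (gen y * u) =
  gen (br x y) * u + gen y * commutator (gen x) u.
Proof.
by rewrite uea_gen_br /commutator mulrBl mulrBr !mulrA addrA subrK.
Qed.

Lemma commutator_gen_prod (S : set U) a (s : seq g) : submodule S ->
  (forall t, size t = size s -> S (\prod_(x <- t) gen x)) ->
  S (commutator (gen a) (\prod_(x <- s) gen x)).
Proof.
elim: s S => [|x s IH] S subS Ss.
  by rewrite big_nil /commutator mulr1 mul1r subrr; apply: submodule0.
rewrite big_cons commutator_genM; apply: submoduleD => //.
  by have := Ss (br a x :: s) erefl; rewrite big_cons.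
apply: (IH ( *%R (gen x) @^-1` S)) => [|t st /=].
  by apply: submodule_preimage subS; apply: mulr_linearr.
by have := Ss (x :: t); rewrite /= st big_cons; apply.
Qed.

Lemma uea_gen_prod_ind (S : set U) :
  submodule S -> (forall s : seq g, S (\prod_(x <- s) gen x)) -> forall u, S u.
Proof.
move=> subS Sprod u; suff: forall s : seq g, S (\prod_(x <- s) gen x * u).
  by move=> /(_ [::]); rewrite big_nil mul1r.
move: u; apply: palg_ind => [|s|x u Su s].
- split=> [s|a u v Su Sv s]; first by rewrite mulr0; apply: submodule0.
  by rewrite mulr_linearr; apply: subS.2.
- by rewrite mulr1.
by have := Su (rcons s x); rewrite big_rcons /= -mulrA.
Qed.

(* Unlike [x * y], the commutator of [x] with a product of [n] elements of g is
   a sum of such products. *)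
Lemma rb_extension_unique RU RU' :
  rb_extension br R RU -> rb_extension br R RU' -> RU = RU'.
Proof.
move=> [RU_linear RU_gen RU1 RUM] [RU'_linear RU'_gen RU'1 RU'M]; apply/funext.
have subS : submodule [set u | RU u = RU' u] by apply: submodule_eq.
apply: (uea_gen_prod_ind subS) => s /=.
have [n] := ubnP (size s); elim: n s => // n IH [|x s] sn.
  by rewrite big_nil RU1 RU'1.
rewrite big_cons RUM RU'M RU_gen RU'_gen IH //; congr (_ - _).
by apply: (commutator_gen_prod _ subS) => t ts; apply: IH; rewrite ts.
Qed.

End RotaBaxterExtension.

(** * Jacobson's formula *)

Section LeftMinusRight.
Variables (B : nzRingType) (a b : B).

Definition lmul_sub_rmul (w : B) : B := a * w - w * b.

Lemma iter_lmul_sub_rmul w n : iter n lmul_sub_rmul w =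
  \sum_(j < n.+1) (a ^+ (n - j) * w * b ^+ j) * ((-1) ^+ j *+ 'C(n, j)).
Proof.
elim: n => [|n IH]; first by rewrite big_ord1 /= !expr0 mulr1 mul1r mulr1.
have sign_comm j m (v : B) : v * ((-1) ^+ j *+ m) = ((-1) ^+ j *+ m) * v.
  exact: (commrMn m (commr_sign v j)).
rewrite iterS IH /lmul_sub_rmul mulr_sumr mulr_suml.
rewrite [RHS]big_ord_recl /= subn0 bin0.
under [X in _ = _ + X]eq_bigr => j _ do
  rewrite /bump add1n binS mulrnDr mulrDr subSS.
rewrite big_split /= [X in X - _]big_ord_recl /= subn0 bin0 !mulr1 -!addrA.
congr (_ + _); first by rewrite mulrA -exprS.
congr (_ + _); last first.
  rewrite -sumrN; apply: eq_bigr => j _.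
  rewrite exprSr exprS mulN1r mulNrn mulrN; congr (- _).
  by rewrite -!mulrA sign_comm !mulrA.
rewrite [RHS]big_ord_recr /= bin_small // mulr0n mulr0 addr0.
apply: eq_bigr => j _; rewrite /bump add1n !mulrA -exprS.
by congr (a ^+ _ * _ * _ * _); have := ltn_ord j; lia.
Qed.

Lemma lmul_sub_rmul_sum w n :
  lmul_sub_rmul (\sum_(j < n.+1) a ^+ (n - j) * w * b ^+ j) =
  a ^+ n.+1 * w - w * b ^+ n.+1.
Proof.
rewrite /lmul_sub_rmul mulr_sumr mulr_suml [X in X - _]big_ord_recl.
rewrite big_ord_recr /= subn0 subnn !expr0 mulr1 mul1r mulrA -exprS -mulrA.
rewrite -exprSr opprD [X in _ + X]addrC addrACA -sumrB big1 ?addr0 // => j _.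
rewrite /bump /= add1n !mulrA -exprS.
have -> : (n - j.+1).+1 = (n - j)%N by have := ltn_ord j; lia.
by rewrite exprSr mulrA subrr.
Qed.

Variable p : nat.
Hypothesis charBp : p \in [pchar B].

Lemma iter_lmul_sub_rmul_pred w : iter p.-1 lmul_sub_rmul w =
  \sum_(j < p.-1.+1) a ^+ (p.-1 - j) * w * b ^+ j.
Proof.
have p_gt0 := prime_gt0 (pcharf_prime charBp).
rewrite iter_lmul_sub_rmul; apply: eq_bigr => j _.
rewrite -mulr_natr (bin_pred_pfactor (e := 1) charBp) ?expn1 //.
  by rewrite -expr2 sqrr_sign mulr1.
by rewrite -[X in (_ < X)%N](prednK p_gt0).
Qed.

Lemma iter_lmul_sub_rmul_pchar w :
  iter p lmul_sub_rmul w = a ^+ p * w - w * b ^+ p.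
Proof.
have p_gt0 := prime_gt0 (pcharf_prime charBp).
by rewrite -(prednK p_gt0) iterS iter_lmul_sub_rmul_pred lmul_sub_rmul_sum.
Qed.

End LeftMinusRight.

Lemma deriv_exp_noncomm (B : nzRingType) (z : {poly B}) n :
  (z ^+ n)^`() = \sum_(j < n) z ^+ (n.-1 - j) * z^`() * z ^+ j.
Proof.
elim: n => [|n IH]; first by rewrite expr0 derivC big_ord0.
rewrite exprSr derivM IH big_ord_recl /= subn0 expr0 mulr1 addrC; congr (_ + _).
rewrite mulr_suml; apply: eq_bigr => j _; rewrite /bump /= add1n -mulrA -exprSr.
by congr (z ^+ _ * _ * _); have := ltn_ord j; lia.
Qed.

Section Pencil.
Variables (k : fieldType) (A : algType k) (x y : A).

Definition pencil : {poly A} := x%:P * 'X + y%:P.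

Lemma coef_pencilM q i : (pencil * q)`_i =
  (if i is j.+1 then x * q`_j else 0) + y * q`_i.
Proof.
rewrite mulrDl coefD coefCM -mulrA -commr_polyX mulrA coefMX.
by case: i => //= i; rewrite coefCM.
Qed.

Lemma coefM_pencil q i : (q * pencil)`_i =
  (if i is j.+1 then q`_j * x else 0) + q`_i * y.
Proof.
rewrite mulrDr coefD coefMC mulrA coefMX.
by case: i => //= i; rewrite coefMC.
Qed.

Lemma coef_iter_ad_pencil n i :
  (iter n (lmul_sub_rmul pencil pencil) x%:P)`_i =
  iter n (ad_txy (@commutator k A) x y) (fun n => if n == 0%N then x else 0) i.
Proof.
elim: n i => [|n IH] i; first by rewrite /= coefC.
rewrite !iterS coefB coef_pencilM coefM_pencil {1}/ad_txy -!IH.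
by case: i => [|i]; rewrite -?IH ?add0r // opprD addrACA.
Qed.

Lemma coef_pencilX_gt n i : (n < i)%N -> (pencil ^+ n)`_i = 0.
Proof.
elim: n i => [|n IH] [|i] // ni; first by rewrite expr0 coef1.
by rewrite exprS coef_pencilM !IH ?mulr0 ?addr0 // ltnW.
Qed.

Lemma coef_pencilX_top n : (pencil ^+ n)`_n = x ^+ n.
Proof.
elim: n => [|n IH]; first by rewrite expr0 coef1.
by rewrite !exprS coef_pencilM IH coef_pencilX_gt ?mulr0 ?addr0.
Qed.

Lemma coef_pencilX_bot n : (pencil ^+ n)`_0 = y ^+ n.
Proof.
elim: n => [|n IH]; first by rewrite expr0 coef1.
by rewrite !exprS coef_pencilM IH add0r.
Qed.

Lemma expD_pencil n : (x + y) ^+ n = \sum_(i < n.+1) (pencil ^+ n)`_i.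
Proof.
have -> : (x + y) ^+ n = (pencil ^+ n).[1].
  rewrite horner_exp_comm; last by rewrite /comm_poly mulr1 mul1r.
  by rewrite hornerMXaddC hornerC mulr1.
have size_pencilX : (size (pencil ^+ n) <= n.+1)%N.
  by apply/leq_sizeP => i; apply: coef_pencilX_gt.
rewrite (horner_coef_wide _ size_pencilX).
by apply: eq_bigr => i _; rewrite expr1n mulr1.
Qed.

Variable p : nat.
Hypothesis charkp : p \in [pchar k].

(* In characteristic p the derivative of the p-th power of the pencil is
   [(ad (t x + y)) ^ (p - 1) x]. *)
Lemma coef_pencilX_jacobson i :
  (0 < i < p)%N -> (pencil ^+ p)`_i = jacobson_s p (@commutator k A) i x y.
Proof.
case: i => // i /andP[_ ip]; have p_gt0 := prime_gt0 (pcharf_prime charkp).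
have charP : p \in [pchar {poly A}] by rewrite pchar_poly pchar_lalg.
rewrite /jacobson_s -coef_iter_ad_pencil (iter_lmul_sub_rmul_pred _ _ charP).
have <- : (pencil ^+ p)^`() =
    \sum_(j < p.-1.+1) pencil ^+ (p.-1 - j) * x%:P * pencil ^+ j.
  by rewrite deriv_exp_noncomm prednK // derivMXaddC derivC mul0r addr0.
rewrite coef_deriv -scaler_nat scalerA mulVf ?scale1r //.
by rewrite -(dvdn_pcharf charkp) gtnNdvd.
Qed.

Theorem jacobson_formula : (x + y) ^+ p =
  x ^+ p + y ^+ p + \sum_(1 <= i < p) jacobson_s p (@commutator k A) i x y.
Proof.
have p_gt0 := prime_gt0 (pcharf_prime charkp).
rewrite expD_pencil -(big_mkord xpredT (fun i => (pencil ^+ p)`_i)).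
rewrite big_nat_recr //= big_ltn // coef_pencilX_bot coef_pencilX_top.
rewrite addrC addrA; congr (_ + _); apply: eq_big_nat => i.
exact: coef_pencilX_jacobson.
Qed.

Lemma iter_commutator_pchar : iter p (commutator x) y = commutator (x ^+ p) y.
Proof.
have charA : p \in [pchar A] by rewrite pchar_lalg.
exact: (iter_lmul_sub_rmul_pchar x x charA).
Qed.

End Pencil.

Lemma iter_commutator_pfactor (k : fieldType) (A : algType k) (x y : A) p n :
    p \in [pchar k] ->
  iter (p ^ n) (commutator x) y = commutator (x ^+ (p ^ n)) y.
Proof.
move=> charkp; elim: n y => [|n IH] y; first by rewrite expr1.
rewrite expnSr exprM -(iter_commutator_pchar _ _ charkp) mulnC iterM.
by congr (iter p _ y); apply/funext.
Qed.

Section NestedBrackets.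
Variables (k : fieldType) (L : lmodType k) (br : L -> L -> L).
Hypothesis brL : lie_algebra br.
Variables x y : L.

Let D i := iter i (br y) x.

(* The sum, over the compositions [al] of [j] of length [r], of the
   [comp_coef al *: [D (al_1 - 1), [.., [D (al_r - 1), w]..]]], computed by
   splitting off the last part. *)
Fixpoint nested (r j : nat) (w : L) : L :=
  match r, j with
  | 0, 0 => w
  | r'.+1, m.+1 =>
    \sum_(i < m.+1) 'C(m, i)%:R *: nested r' (m - i) (br (D i) w)
  | _, _ => 0
  end.

Definition nested_last (r m : nat) (Y : nat -> L) : L :=
  \sum_(i < m.+1) 'C(m, i)%:R *: nested r (m - i) (Y i).

Lemma nested_linear r j : linear (nested r j).
Proof.
elim: r j => [|r IH] [|m] //= a u v; rewrite ?scaler0 ?addr0 //.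
rewrite scaler_sumr -big_split; apply: eq_bigr => i _ /=.
by rewrite (lie_linearr brL) IH scalerDr !scalerA mulrC.
Qed.

HB.instance Definition _ r j :=
  GRing.isLinear.Build k L L *:%R (nested r j) (nested_linear r j).

Lemma nested_lastB r m Y Z :
  nested_last r m (fun i => Y i - Z i) = nested_last r m Y - nested_last r m Z.
Proof.
rewrite /nested_last -sumrB; apply: eq_bigr => i _.
by rewrite linearB scalerBr.
Qed.

Lemma nested_lastN r m Y :
  nested_last r m (fun i => - Y i) = - nested_last r m Y.
Proof.
rewrite /nested_last -sumrN; apply: eq_bigr => i _.
by rewrite linearN scalerN.
Qed.

Let nested_pred (r j : nat) (w : L) := if r is r'.+1 then nested r' j w else 0.

Lemma nested_lastS r m Y :
    (forall j w, nested r j.+1 w = br x (nested_pred r j w) +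
      (br y (nested r j w) - nested r j (br y w))) ->
  nested_last r m.+1 Y =
    br x (\sum_(i < m.+1) 'C(m, i)%:R *: nested_pred r (m - i) (Y i)) +
    (br y (nested_last r m Y) - nested_last r m (fun i => br y (Y i))) +
    nested_last r m (fun i => Y i.+1).
Proof.
move=> nestedS; rewrite /nested_last [LHS]big_ord_recl /= bin0 scale1r subn0.
under [X in _ + X]eq_bigr => i _ do
  rewrite /bump /= add1n binS natrD scalerDl subSS.
rewrite big_split /= addrA; congr (_ + _).
transitivity (\sum_(i < m.+2) 'C(m, i)%:R *: nested r (m.+1 - i) (Y i)).
  by rewrite [RHS]big_ord_recl /= bin0 scale1r subn0.
rewrite big_ord_recr /= bin_small // scale0r addr0.
rewrite !(lie_sumr brL) -sumrB -big_split.
apply: eq_bigr => i _ /=; rewrite subSn ?nestedS; last by rewrite -ltnS.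
by rewrite !(lieZr brL) -scalerBr -scalerDr.
Qed.

(* The bracket with [y] acts as a derivation on [nested r j w], and increasing
   one of the parts by one is bracketing [y] with the corresponding factor. *)
Lemma nestedS r j w : nested r j.+1 w = br x (nested_pred r j w) +
  (br y (nested r j w) - nested r j (br y w)).
Proof.
elim: r j w => [|r IH] j w.
  rewrite /= (lie0r brL) add0r.
  by case: j => [|j] /=; rewrite ?(lie0r brL) subrr.
case: j => [|m].
  rewrite /= big_ord1 /= bin0 scale1r (lie0r brL) subrr addr0.
  by case: (r) => //=; rewrite (lie0r brL).
rewrite -[nested r.+1 m.+2 w]/(nested_last r m.+1 (fun i => br (D i) w)).
rewrite nested_lastS // -!addrA; congr (_ + (_ + _)).
  by congr (br x _); case: (r) => //=; rewrite big1 // => i _; rewrite scaler0.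
rewrite -[nested r.+1 m.+1 _]/(nested_last r m (fun i => br (D i) (br y w))).
rewrite addrC -nested_lastB -nested_lastN; congr (nested_last r m _).
apply/funext => i.
by rewrite [br y (br _ _)](lie_jacobi brL) opprD addrA subrr sub0r.
Qed.

Lemma iter_ad_txy n r :
  iter n (ad_txy br x y) (fun i => if i == 0%N then x else 0) r =
  nested_last r n D.
Proof.
elim: n r => [|n IH] r.
  by rewrite /nested_last big_ord1 /= bin0 scale1r; case: r.
rewrite iterS {1}/ad_txy nested_lastS; last exact: nestedS.
rewrite -addrA addrNK IH; congr (_ + _).
case: r => [|r]; last by rewrite IH.
by rewrite big1 ?(lie0r brL) // => i _; rewrite scaler0.
Qed.

End NestedBrackets.

Lemma comp_coef_rcons s m : comp_coef (rcons s m) =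
  (comp_coef s * 'C((sumn s + m).-1, m.-1))%N.
Proof.
rewrite /comp_coef size_rcons big_ord_recr /=; congr (_ * 'C(_.-1, _.-1))%N.
- apply: eq_bigr => i _; rewrite -cats1 takel_cat // nth_cat.
  by rewrite ltn_ord.
- by rewrite -[(size s).+1](size_rcons s m) take_size sumn_rcons.
- by rewrite nth_rcons ltnn eqxx.
Qed.

Lemma big_tuple_rcons (V : nmodType) (T : finType) r (F : r.+1.-tuple T -> V) :
  \sum_(al : r.+1.-tuple T) F al =
  \sum_(i : T) \sum_(al : r.-tuple T) F [tuple of rcons al i].
Proof.
rewrite pair_big /=.
rewrite (reindex (fun ia : T * r.-tuple T => [tuple of rcons ia.2 ia.1])) //=.
apply/onW_bij/inj_card_bij; last by rewrite card_prod !card_tuple expnS.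
by move=> [i al] [j be] /(congr1 val)/= /rcons_inj[/val_inj-> ->].
Qed.

Section CompositionSums.
Variables (k : fieldType) (L : lmodType k) (p : nat).
Implicit Types (F : seq nat -> L) (n r : nat).

Definition bounded_composition n r (al : r.-tuple 'I_p.+1) : bool :=
  all (fun i : 'I_p.+1 => (0 < i)%N) al && (sumn [seq val i | i <- al] == n).

Definition composition_sum n r F : L :=
  \sum_(al : r.-tuple 'I_p.+1 | bounded_composition n al)
    (comp_coef [seq val i | i <- al])%:R *: F [seq val i | i <- al].

Lemma composition_sum_parts0 n F :
  composition_sum n 0 F = if n == 0%N then F [::] else 0.
Proof.
rewrite /composition_sum big_mkcond (big_pred1 [tuple]) => [|al]; last first.
  by apply/esym/eqP/val_inj; case: al => -[].
rewrite /bounded_composition /= eq_sym; case: eqP => // _.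
by rewrite /comp_coef big_ord0 scale1r.
Qed.

Lemma composition_sum0S r F : composition_sum 0 r.+1 F = 0.
Proof.
rewrite /composition_sum big1 // => al /andP[]; case/tupleP: al => i al /=.
by case: (nat_of_ord i).
Qed.

Lemma composition_sumSS n r F : (n < p)%N ->
  composition_sum n.+1 r.+1 F = \sum_(i < n.+1)
    'C(n, i)%:R *: composition_sum (n - i) r (fun s => F (rcons s i.+1)).
Proof.
move=> np; rewrite /composition_sum big_mkcond big_tuple_rcons.
rewrite big_ord_recl [X in X + _]big1 ?add0r; last first.
  by move=> al _; rewrite /bounded_composition /= all_rcons.
rewrite (big_ord_widen p (fun i => 'C(n, i)%:R *:
  composition_sum (n - i) r (fun s => F (rcons s i.+1)))) //.
rewrite [RHS]big_mkcond; apply: eq_bigr => i _ /=.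
rewrite -big_mkcond /=; case: ifP => [iN|/negbT iN]; last first.
  rewrite big1 // => al.
  rewrite /bounded_composition /= all_rcons map_rcons sumn_rcons.
  by move=> /andP[_ /eqP/= E]; move: iN E; rewrite /bump /=; lia.
rewrite scaler_sumr; apply: eq_big => al.
  rewrite /bounded_composition /= all_rcons map_rcons sumn_rcons /= /bump /=.
  by rewrite add1n; congr (_ && _); lia.
move=> /andP[_ /eqP]; rewrite /= map_rcons sumn_rcons /= /bump /= add1n => E.
rewrite comp_coef_rcons natrM scalerA; congr (_ *: _); rewrite mulrC.
by congr ('C(_, _)%:R * _); rewrite E.
Qed.

Variable br : L -> L -> L.
Variables x y : L.
Let D i := iter i (br y) x.

Lemma nested_composition_sum r j w : (j <= p)%N -> nested br x y r j w =
  composition_sum j r (foldr (fun i v => br (D i.-1) v) w).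
Proof.
elim: r j w => [|r IH] [|m] w jp;
  rewrite ?composition_sum_parts0 ?composition_sum0S //.
rewrite composition_sumSS // [LHS]/=; apply: eq_bigr => i _.
rewrite IH; last by rewrite (leq_trans (leq_subr _ _)) // ltnW.
by congr (_ *: composition_sum _ _ _); apply/funext => s; rewrite foldr_rcons.
Qed.

Hypothesis brL : lie_algebra br.

Lemma jacobson_s_compositions r : (0 < r < p)%N ->
  jacobson_s p br r x y = r%:R^-1 *:
    \sum_(al : r.-tuple 'I_p.+1 | is_composition al)
      (comp_coef [seq val i | i <- al])%:R *:
        iter_br br [seq D (val i).-1 | i <- al].
Proof.
case: r => // r /andP[_ rp]; have p_gt0 : (0 < p)%N by apply: leq_trans rp.
rewrite /jacobson_s (iter_ad_txy brL); congr (_ *: _).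
have iter_br_rcons s m : iter_br br (rcons [seq D i.-1 | i <- s] (D m)) =
    foldr (fun i v => br (D i.-1) v) (D m) s.
  by elim: s => //= i s <-; case: s.
pose nested_br s := iter_br br [seq D i.-1 | i <- s].
transitivity (composition_sum p r.+1 nested_br).
  rewrite -[X in composition_sum X](prednK p_gt0) composition_sumSS; last first.
    by rewrite prednK.
  apply: eq_bigr => i _; rewrite nested_composition_sum; last first.
    by rewrite (leq_trans (leq_subr _ _)) // leq_pred.
  congr (_ *: composition_sum _ _ _); apply/funext => s.
  by rewrite /nested_br map_rcons iter_br_rcons.
by apply: eq_bigr => al _; rewrite /nested_br -map_comp.
Qed.

End CompositionSums.

(** * Restricted Lie algebras *)

Lemma iter_morph (T T' : Type) (f : T -> T') (h : T -> T) (h' : T' -> T') :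
    (forall v, f (h v) = h' (f v)) ->
  forall n v, f (iter n h v) = iter n h' (f v).
Proof. by move=> fh; elim=> // n IH v; rewrite !iterS fh IH. Qed.

Lemma commutator_lie_algebra (k : fieldType) (A : algType k) :
  lie_algebra (@commutator k A).
Proof.
split=> [x|y|x|x y z]; rewrite /commutator ?subrr //.
- exact: commutator_linearr.
- exact: commutator_linearl.
rewrite !mulrBr !mulrBl !mulrA !opprB !addrA.
rewrite [LHS](ACl ((1*12)*(2*7)*(3*10)*(4*5)*(6*11)*(8*9))) /=.
by rewrite !(subrr, addNr, addr0).
Qed.

Lemma algebra_p_map (k : fieldType) (A : algType k) p : p \in [pchar k] ->
  p_map p (@commutator k A) (fun u => u ^+ p).
Proof.
move=> charkp; split=> [a x|x y|x y]; first exact: exprZn.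
  by rewrite iter_commutator_pchar.
exact: jacobson_formula.
Qed.

Section JacobsonMembership.
Variables (k : fieldType) (L : lmodType k) (br : L -> L -> L) (S T : set L).
Hypotheses (subS : submodule S) (subT : submodule T) (ST : S `<=` T).
Hypothesis brT : forall u v, T u -> T v -> S (br u v).

Lemma jacobson_s_mem p i u v :
  (1 < p)%N -> T u -> T v -> S (jacobson_s p br i u v).
Proof.
move=> p_gt1 Tu Tv; apply: (submoduleZ subS).
have p1_gt0 : (0 < p.-1)%N by rewrite -subn1 subn_gt0.
set s := fun n => _.
have iterT n j : T (iter n (ad_txy br u v) s j).
  elim: n j => [|n IH] j.
    by rewrite /= /s; case: ifP => // _; apply: submodule0.
  rewrite iterS /ad_txy; apply: (submoduleD subT); last exact/ST/brT.
  by case: j => [|j]; [exact: submodule0 | exact/ST/brT].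
rewrite -(prednK p1_gt0) iterS /ad_txy.
apply: (submoduleD subS); last exact: brT.
by case: i.-1 => [|j]; [exact: submodule0 | exact: brT].
Qed.

End JacobsonMembership.

Section LieMorphisms.
Variables (k : fieldType) (L M : lmodType k).
Variables (brL : L -> L -> L) (brM : M -> M -> M) (f : {linear L -> M}).
Hypothesis f_br : forall u v, f (brL u v) = brM (f u) (f v).

Lemma ad_txy_morph x y v n i : f (iter n (ad_txy brL x y) v i) =
  iter n (ad_txy brM (f x) (f y)) (f \o v) i.
Proof.
elim: n i => [//|n IH] i; rewrite !iterS {1 3}/ad_txy linearD f_br IH.
by case: i => [|i]; rewrite ?linear0 ?f_br ?IH.
Qed.

Lemma jacobson_s_morph p i x y :
  f (jacobson_s p brL i x y) = jacobson_s p brM i (f x) (f y).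
Proof.
rewrite /jacobson_s linearZ /= ad_txy_morph.
have -> // : f \o (fun j => if j == 0%N then x else 0) =
  (fun j => if j == 0%N then f x else 0).
by apply/funext => j /=; case: ifP; rewrite ?linear0.
Qed.

Lemma lie_algebra_inj : injective f -> lie_algebra brM -> lie_algebra brL.
Proof.
move=> f_inj [lr ll xx J]; split=> [x a u v|y a u v|x|x y z]; apply: f_inj.
- by rewrite !(f_br, linearP) lr.
- by rewrite !(f_br, linearP) ll.
- by rewrite f_br xx linear0.
- by rewrite !(linearD, f_br) J linear0.
Qed.

Variables (p : nat) (pmL : L -> L) (pmM : M -> M).

Lemma p_map_inj : injective f -> (forall x, f (pmL x) = pmM (f x)) ->
  p_map p brM pmM -> p_map p brL pmL.
Proof.
move=> f_inj f_pm [pmZ pm_br pmD]; split=> [a x|x y|x y]; apply: f_inj.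
- by rewrite linearZ !f_pm linearZ pmZ.
- by rewrite f_br f_pm pm_br (iter_morph (f_br x)).
- rewrite !linearD !f_pm linearD pmD linear_sum; congr (_ + _).
  by apply: eq_bigr => i _; rewrite jacobson_s_morph.
Qed.

Hypothesis p_gt0 : (0 < p)%N.
Hypotheses (pmLP : p_map p brL pmL) (pmMP : p_map p brM pmM).

Lemma p_map_morph_submodule : submodule [set x | f (pmL x) = pmM (f x)].
Proof.
have [pmLZ _ pmLD] := pmLP; have [pmMZ _ pmMD] := pmMP.
split=> [|a x y /= fx fy].
  have := pmLZ 0 0; have := pmMZ 0 0; rewrite expr0n gtn_eqF // !scale0r.
  by move=> pmM0 pmL0; rewrite /= pmL0 linear0 pmM0.
rewrite pmLD linearP pmMD !linearD linear_sum pmLZ pmMZ linearZ /= fx fy.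
congr (_ + _); apply: eq_bigr => i _.
by rewrite jacobson_s_morph linearZ.
Qed.

End LieMorphisms.

Lemma p_map_iter (k : fieldType) p (L : lmodType k) (br : L -> L -> L)
    (pm : L -> L) x y n :
  p_map p br pm -> br (iter n pm x) y = iter (p ^ n) (br x) y.
Proof.
move=> [_ pmbr _]; elim: n y => [//|n IH] y.
rewrite iterS pmbr expnS iterM; congr (iter p _ y).
exact/funext.
Qed.

Lemma p_map_R_weight1 (k : fieldType) p (L : lmodType k) (br : L -> L -> L)
    (pm R : L -> L) x :
    lie_algebra br -> p_map p br pm ->
  p_map_R p 1 br pm R x = pm (x + R x) - pm (R x).
Proof.
move=> brL [_ _ pmD]; rewrite pmD /p_map_R expr1n scale1r.
rewrite -[RHS]addrA [X in _ = _ + X]addrC addrA addrK; congr (_ + _).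
apply: eq_big_nat => r rp; rewrite jacobson_s_compositions //.
by rewrite expr1n mulr1.
Qed.

Section RestrictedRotaBaxterMorphisms.
Variables (k : fieldType) (p : nat) (L M : lmodType k).
Variables (brL : L -> L -> L) (pmL RL : L -> L).
Variables (brM : M -> M -> M) (pmM RM : M -> M).
Hypothesis LP : restricted_rb_lie_algebra p 1 brL pmL RL.
Hypothesis MP : restricted_rb_lie_algebra p 1 brM pmM RM.
Variable f : {linear L -> M}.
Hypothesis f_pm : forall x, f (pmL x) = pmM (f x).

(* The p-map differs from [x -> (x + R x)^[p] - (R x)^[p]], whose composition
   with R is [x -> (R x)^[p]], by the terms of Jacobson's formula. *)
Lemma rb_compat_p_map x : f (RL x) = RM (f x) ->
    let s := \sum_(1 <= i < p) jacobson_s p brL i x (RL x) in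
    f (RL s) = RM (f s) ->
  f (RL (pmL x)) = RM (f (pmL x)).
Proof.
have [[brLL [RL_linear _]] pmLP pmL_R] := LP.
have [[brML [RM_linear _]] pmMP pmM_R] := MP.
have RLB := GRing.zmod_morphism_linear RL_linear.
have RMB := GRing.zmod_morphism_linear RM_linear.
move=> fRx s fRs.
have pmE : pmL x = (pmL (x + RL x) - pmL (RL x)) - s.
  by have [_ _ ->] := pmLP; rewrite addrAC addrK addrK.
have := pmM_R (f x); have := pmL_R x.
rewrite (p_map_R_weight1 _ _ brLL pmLP) (p_map_R_weight1 _ _ brML pmMP).
move=> RxE RfxE; rewrite [in LHS]pmE RLB RxE linearB [in LHS]f_pm fRx fRs.
rewrite -RfxE -RMB.
by congr RM; rewrite [in RHS]pmE !linearB !f_pm linearD fRx.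
Qed.

End RestrictedRotaBaxterMorphisms.

(** * The universal envelope *)

Section PowerSpanClosure.
Variables (k : fieldType) (p : nat).
Hypothesis charkp : p \in [pchar k].
Variables (g : lmodType k) (br : g -> g -> g).
Notation gen := (uea_gen br).
Notation comm := (@commutator k (uea br)).

Lemma range_gen_submodule : submodule (range gen).
Proof. exact: submodule_image. Qed.

Lemma iter_commutator_gen x n u :
  range gen u -> range gen (iter n (comm (gen x)) u).
Proof.
move=> [y _ <-]; exists (iter n (br x) y) => //.
by apply: iter_morph => v; rewrite uea_gen_br.
Qed.

Lemma gp_set_commutator_gen u v :
  gp_set p br u -> gp_set p br v -> range gen (comm u v).
Proof.
have range_sub := range_gen_submodule.
have comm_gen w y : gp_set p br w -> range gen (comm w (gen y)).
  move: w; apply: gp_set_ind => [|x n].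
    by apply: submodule_preimage range_sub; apply: commutator_linearl.
  rewrite /= -(iter_commutator_pfactor _ _ _ charkp).
  by apply: iter_commutator_gen; exists y.
move=> gu gv; move: u gu; apply: gp_set_ind => [|x n].
  by apply: submodule_preimage range_sub; apply: commutator_linearl.
have p_gt0 := prime_gt0 (pcharf_prime charkp).
have pn_gt0 : (0 < p ^ n)%N by rewrite expn_gt0 p_gt0.
rewrite /= -(iter_commutator_pfactor _ _ _ charkp) -(prednK pn_gt0) iterSr.
apply: iter_commutator_gen; rewrite commutator_anti.
by apply: (submoduleN range_sub); apply: comm_gen.
Qed.

Lemma range_gen_gp_set : range gen `<=` gp_set p br.
Proof. by move=> _ [x _ <-]; apply: gp_set_gen. Qed.

Lemma gp_set_commutator u v :
  gp_set p br u -> gp_set p br v -> gp_set p br (comm u v).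
Proof.
by move=> gu gv; apply/range_gen_gp_set/gp_set_commutator_gen.
Qed.

Lemma gp_set_jacobson_gen i u v :
  gp_set p br u -> gp_set p br v -> range gen (jacobson_s p comm i u v).
Proof.
have p_gt1 := prime_gt1 (pcharf_prime charkp).
apply: jacobson_s_mem p_gt1 => //.
- exact: range_gen_submodule.
- exact: gp_set_submodule.
- exact: range_gen_gp_set.
- exact: gp_set_commutator_gen.
Qed.

End PowerSpanClosure.

Section ExtensionOnPowerSpan.
Variables (k : fieldType) (p : nat).
Hypothesis charkp : p \in [pchar k].
Variables (g : lmodType k) (br : g -> g -> g).
Hypothesis brL : lie_algebra br.
Variables (R : g -> g) (RU : uea br -> uea br).
Hypothesis RUP : rb_extension br R RU.
Notation U := (uea br).
Notation gen := (uea_gen br).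
Notation comm := (@commutator k U).

Lemma rb_extension_linear : linear RU. Proof. by case: RUP. Qed.

HB.instance Definition _ :=
  GRing.isLinear.Build k U U *:%R RU rb_extension_linear.

Definition rb_left_factor : set U :=
  [set u | gp_set p br (RU u) /\
    forall v, RU u * RU v = RU (u * v + comm (RU u) v)].

Lemma rb_left_factor_submodule : submodule rb_left_factor.
Proof.
have gp_sub := gp_set_submodule p br.
split=> [|a u w [gu Ru] [gw Rw]].
  split=> [|v]; first by rewrite linear0; apply: submodule0.
  by rewrite linear0 /commutator !mul0r mulr0 subrr addr0 linear0.
split=> [|v]; first by rewrite linearP; apply: gp_sub.2.
rewrite linearP !mulr_linearl commutator_linearl Ru Rw -[LHS]linearP.
by rewrite scalerDr addrACA.
Qed.

Lemma rb_left_factor_gen x : rb_left_factor (gen x).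
Proof.
have [_ RU_gen _ RUM] := RUP.
split=> [|v]; first by rewrite RU_gen; apply: gp_set_gen.
by rewrite linearD /= RUM addrNK.
Qed.

(* Left multiplication by [u] plus [ad (RU u)] is the difference of the
   commuting operators [u + RU u] on the left and [RU u] on the right, so its
   [p]-th power is the difference of their [p]-th powers. *)
Lemma rb_left_factor_expM u v : rb_left_factor u -> RU u ^+ p * RU v =
  RU ((u + RU u) ^+ p * v - v * RU u ^+ p).
Proof.
move=> [_ Ru]; have charU : p \in [pchar U] by rewrite pchar_lalg.
rewrite -(iter_lmul_sub_rmul_pchar _ _ charU).
elim: (p) v => [|n IH] v; first by rewrite mul1r.
rewrite exprS -mulrA IH Ru iterS; congr RU.
by rewrite /lmul_sub_rmul mulrDl /commutator addrA.
Qed.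

Lemma rb_left_factor_exp u : rb_left_factor u ->
  RU ((u + RU u) ^+ p - RU u ^+ p) = RU u ^+ p.
Proof.
case: RUP => _ _ RU1 _ /(rb_left_factor_expM 1).
by rewrite RU1 !mulr1 mul1r.
Qed.

Lemma rb_left_factorX u :
  gp_set p br u -> rb_left_factor u -> rb_left_factor (u ^+ p).
Proof.
move=> gu uP; have [gRu _] := uP.
have powP : rb_left_factor ((u + RU u) ^+ p - RU u ^+ p).
  split=> [|v]; rewrite rb_left_factor_exp //; first exact: gp_setX.
  rewrite rb_left_factor_expM //; congr RU.
  by rewrite mulrBl /commutator addrA subrK.
have -> : u ^+ p = (u + RU u) ^+ p - RU u ^+ p -
    \sum_(1 <= i < p) jacobson_s p comm i u (RU u).
  by rewrite (jacobson_formula _ _ charkp) addrAC addrK addrK.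
apply: (submoduleB rb_left_factor_submodule) => //.
apply: (submodule_sum rb_left_factor_submodule) => i _ _.
have [y _ <-] := gp_set_jacobson_gen charkp i gu gRu.
exact: rb_left_factor_gen.
Qed.

Lemma gp_set_rb_left_factor u : gp_set p br u -> rb_left_factor u.
Proof.
apply: gp_set_ind => [|x n]; first exact: rb_left_factor_submodule.
elim: n => [|n IH]; first exact: rb_left_factor_gen.
by rewrite expnSr exprM; apply: rb_left_factorX => //; apply: gp_set_genX.
Qed.

End ExtensionOnPowerSpan.

Section EnvelopeOperations.
Variables (k : fieldType) (p : nat) (g : lmodType k) (br : g -> g -> g).
Notation U := (uea br).
Notation gpT := (gp p br).

(* The value outside [gp_set] is [0]. *)
Definition to_gp (u : U) : gpT := insubd (0 : gpT) u.

Lemma to_gpK u : gp_set p br u -> gp_val (to_gp u) = u.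
Proof. by move=> gu; apply: insubdK; apply/asboolP. Qed.

Lemma gp_valP (u : gpT) : gp_set p br (gp_val u).
Proof. by apply/asboolP; apply: valP u. Qed.

Lemma gp_val_inj : injective (@gp_val k p g br).
Proof. exact: val_inj. Qed.

Lemma gp_val_linear : linear (@gp_val k p g br).
Proof. by move=> a u v; rewrite -[gp_val _]/(val _) linearP. Qed.

HB.instance Definition _ :=
  GRing.isLinear.Build k gpT U *:%R (@gp_val k p g br) gp_val_linear.

Definition gp_bracket (u v : gpT) : gpT :=
  to_gp (commutator (gp_val u) (gp_val v)).
Definition gp_power (u : gpT) : gpT := to_gp (gp_val u ^+ p).
Definition gp_rb (RU : U -> U) (u : gpT) : gpT := to_gp (RU (gp_val u)).
Definition gp_gen (x : g) : gpT := to_gp (uea_gen br x).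

Lemma gp_genE x : gp_val (gp_gen x) = uea_gen br x.
Proof. exact/to_gpK/gp_set_gen. Qed.

Hypothesis charkp : p \in [pchar k].

Lemma gp_bracketE u v :
  gp_val (gp_bracket u v) = commutator (gp_val u) (gp_val v).
Proof. by apply: to_gpK; apply: gp_set_commutator (gp_valP u) (gp_valP v). Qed.

Lemma gp_lie_algebra : lie_algebra gp_bracket.
Proof.
apply: (lie_algebra_inj (f := @gp_val k p g br) gp_bracketE gp_val_inj).
exact: commutator_lie_algebra.
Qed.

Lemma gp_jacobson_gen i u v : range gp_gen (jacobson_s p gp_bracket i u v).
Proof.
have [x _ xE] := gp_set_jacobson_gen charkp i (gp_valP u) (gp_valP v).
exists x => //; apply: gp_val_inj; rewrite gp_genE xE.
by rewrite (jacobson_s_morph (f := @gp_val k p g br) gp_bracketE).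
Qed.

Hypothesis brL : lie_algebra br.

Lemma gp_powerE u : gp_val (gp_power u) = gp_val u ^+ p.
Proof. by apply: to_gpK; apply: gp_setX (gp_valP u). Qed.

Lemma gp_p_map : p_map p gp_bracket gp_power.
Proof.
apply: (p_map_inj (f := @gp_val k p g br) gp_bracketE gp_val_inj gp_powerE).
exact: algebra_p_map.
Qed.

Lemma gp_gen_power_ind (S : set gpT) : submodule S ->
    (forall x, S (gp_gen x)) -> (forall u, S u -> S (gp_power u)) ->
  forall u, S u.
Proof.
move=> subS Sgen SX u; suff [w Sw /gp_val_inj<-//] : (@gp_val k p g br @` S) u.
move: (gp_val u) (gp_valP u) => {u}; apply: gp_set_ind => [|x n].
  exact: submodule_image.
elim: n => [|n [u Su uE]].
  by exists (gp_gen x); rewrite ?gp_genE.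
by exists (gp_power u); [apply: SX | rewrite gp_powerE uE -exprM -expnSr].
Qed.

Variables (R : g -> g) (RU : U -> U).
Hypothesis RUP : rb_extension br R RU.

Let RU_linear : linear RU := rb_extension_linear RUP.

HB.instance Definition _ := GRing.isLinear.Build k U U *:%R RU RU_linear.

Lemma gp_rbE u : gp_val (gp_rb RU u) = RU (gp_val u).
Proof.
by apply: to_gpK; have [] := gp_set_rb_left_factor charkp brL RUP (gp_valP u).
Qed.

Lemma gp_rb_gen x : gp_rb RU (gp_gen x) = gp_gen (R x).
Proof.
have [_ RU_gen _ _] := RUP; apply: gp_val_inj.
by rewrite gp_rbE !gp_genE RU_gen.
Qed.

Lemma gp_rota_baxter : rota_baxter 1 gp_bracket (gp_rb RU).
Proof.
split=> [a u v|u v]; apply: gp_val_inj.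
  by rewrite linearP /= !gp_rbE !linearP.
rewrite scale1r !linearD /= !(gp_bracketE, gp_rbE) -!linearD.
have [_ uP] := gp_set_rb_left_factor charkp brL RUP (gp_valP u).
have [_ vP] := gp_set_rb_left_factor charkp brL RUP (gp_valP v).
rewrite {1}/commutator uP vP -linearB; congr RU.
by rewrite /commutator !opprD !opprK !addrA [LHS](ACl (2*3*6*5*1*4)).
Qed.

Theorem gp_restricted :
  restricted_rb_lie_algebra p 1 gp_bracket gp_power (gp_rb RU).
Proof.
split; [|exact: gp_p_map|].
  by split; [exact: gp_lie_algebra | exact: gp_rota_baxter].
move=> u; rewrite (p_map_R_weight1 _ _ gp_lie_algebra gp_p_map).
apply: gp_val_inj; rewrite gp_rbE [gp_val (_ - _)]linearB /= !gp_powerE.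
rewrite [gp_val (_ + _)]linearD /= !gp_rbE.
apply: (rb_left_factor_exp charkp RUP).
exact: (gp_set_rb_left_factor charkp brL RUP (gp_valP u)).
Qed.

Lemma gp_gen_hom : rb_hom br R gp_bracket (gp_rb RU) gp_gen.
Proof.
split=> [a x y|x y|x]; last by rewrite gp_rb_gen.
  by apply: gp_val_inj; rewrite linearP /= !gp_genE linearP.
by apply: gp_val_inj; rewrite gp_bracketE !gp_genE uea_gen_br.
Qed.

Theorem gp_envelope :
  rb_p_envelope p 1 br R gp_bracket gp_power (gp_rb RU) gp_gen.
Proof.
split.
- exact: gp_restricted.
- exact: gp_gen_hom.
- move=> x y /(congr1 (@gp_val k p g br)); rewrite !gp_genE.
  exact: uea_gen_inj.
- apply/seteqP; split=> // u _ S [[[S0 SP] _ _ SX] Sgen].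
  by apply: (gp_gen_power_ind (S := S)) => // x; apply: Sgen; exists x.
Qed.

End EnvelopeOperations.

Section UniversalProperty.
Variables (k : fieldType) (p : nat).
Hypothesis charkp : p \in [pchar k].
Variables (g : lmodType k) (br : g -> g -> g) (R : g -> g).
Hypothesis brL : lie_algebra br.
Variable RU : uea br -> uea br.
Hypothesis RUP : rb_extension br R RU.
Notation U := (uea br).
Notation gpT := (gp p br).
Notation gen := (uea_gen br).
Notation comm := (@commutator k U).

Variables (c : lmodType k) (brc : c -> c -> c) (pmc Rc : c -> c).
Hypothesis cP : restricted_rb_lie_algebra p 1 brc pmc Rc.
Variable f : g -> c.
Hypothesis fP : rb_hom br R brc Rc f.

Let brcL : lie_algebra brc. Proof. by case: cP => -[]. Qed.
Let pmcP : p_map p brc pmc. Proof. by case: cP. Qed.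
Let Rc_linear : linear Rc. Proof. by case: cP => -[_ []]. Qed.
Let f_linear : linear f. Proof. by case: fP. Qed.
Let f_br x y : f (br x y) = brc (f x) (f y). Proof. by case: fP. Qed.
Let f_R x : f (R x) = Rc (f x). Proof. by case: fP. Qed.

HB.instance Definition _ := GRing.isLinear.Build k g c *:%R f f_linear.

Section EnvelopeMap.
Variables (d : Order.disp_t) (I : orderType d) (e : I -> g).
Hypothesis e_basis : is_basis e.

(* Only the values at the words [e_i ^ (p ^ n)] matter. *)
Definition envelope_map : {linear U -> c} := pbw_ext brL e_basis
  (fun w => if w is i :: _ then iter (logn p (size w)) pmc (f (e i)) else 0).

Lemma envelope_map_power i n :
  envelope_map (gen (e i) ^+ (p ^ n)) = iter n pmc (f (e i)).
Proof.
have p_pr := pcharf_prime charkp.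
have pn_gt0 : (0 < p ^ n)%N by rewrite expn_gt0 prime_gt0.
rewrite -uea_word_nseq pbw_extE; last first.
  by elim: (p ^ n)%N => // -[|m] //= ->; rewrite lexx.
by rewrite -(prednK pn_gt0) /= size_nseq (prednK pn_gt0) pfactorK.
Qed.

Lemma envelope_map_gen x : envelope_map (gen x) = f x.
Proof.
move: x; apply: (eq_on_basis e_basis (f := envelope_map \o gen)) => [||i].
- exact: linearP.
- exact: linearP.
- exact: (envelope_map_power i 0).
Qed.

Lemma envelope_map_commutator_gen u y : gp_set p br u ->
  envelope_map (comm u (gen y)) = brc (envelope_map u) (f y).
Proof.
move: u; apply: (gp_set_basis_ind charkp brL e_basis) => [|i n].
  apply: submodule_eq => a v w; first by rewrite commutator_linearl linearP.
  by rewrite linearP (lie_linearl brcL).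
rewrite /= -(iter_commutator_pfactor _ _ _ charkp) envelope_map_power.
rewrite (p_map_iter _ _ _ pmcP).
rewrite -(iter_morph (f := gen) (h := br (e i))); last exact: uea_gen_br.
by rewrite envelope_map_gen (iter_morph (f_br (e i))).
Qed.

Lemma envelope_map_commutator u v : gp_set p br u -> gp_set p br v ->
  envelope_map (comm u v) = brc (envelope_map u) (envelope_map v).
Proof.
move=> gu gv; move: u gu.
apply: (gp_set_basis_ind charkp brL e_basis) => [|i n].
  apply: submodule_eq => a w w'; first by rewrite commutator_linearl linearP.
  by rewrite linearP (lie_linearl brcL).
rewrite /= -(iter_commutator_pfactor _ _ _ charkp) envelope_map_power.
rewrite (p_map_iter _ _ _ pmcP); elim: (p ^ n)%N => // m IH.
rewrite !iterS -IH commutator_anti linearN envelope_map_commutator_gen.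
  by rewrite -(lie_anti brcL).
elim: m {IH} => // m IH.
by rewrite iterS; apply: gp_set_commutator => //; apply: gp_set_gen.
Qed.

Definition gp_map : {linear gpT -> c} := envelope_map \o @gp_val k p g br.

Lemma gp_map_gen x : gp_map (gp_gen p br x) = f x.
Proof. by rewrite /gp_map /= gp_genE envelope_map_gen. Qed.

Lemma gp_map_bracket u v : gp_map (gp_bracket u v) = brc (gp_map u) (gp_map v).
Proof.
by rewrite /gp_map /= gp_bracketE // envelope_map_commutator //; apply: gp_valP.
Qed.

Lemma gp_map_power u : gp_map (gp_power u) = pmc (gp_map u).
Proof.
have p_gt0 := prime_gt0 (pcharf_prime charkp).
have compatP := p_map_morph_submodule gp_map_bracket p_gt0 (gp_p_map charkp brL)
  pmcP.
suff [w wP /gp_val_inj<-//] :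
  (@gp_val k p g br @` [set u | gp_map (gp_power u) = pmc (gp_map u)]) u.
move: (gp_val u) (gp_valP u) => {u}.
apply: (gp_set_basis_ind charkp brL e_basis) => [|i n].
  exact: (submodule_image _ compatP).
exists (to_gp p (gen (e i) ^+ (p ^ n))); last exact/to_gpK/gp_set_genX.
rewrite /= gp_powerE // to_gpK; last exact: gp_set_genX.
by rewrite -exprM -expnSr !envelope_map_power.
Qed.

Lemma gp_map_rb u : gp_map (gp_rb RU u) = Rc (gp_map u).
Proof.
have gpP := gp_restricted charkp brL RUP.
have gp_rb_linear : linear (@gp_rb k p g br RU) by case: gpP => -[_ []].
pose compat : set gpT := [set v | gp_map (gp_rb RU v) = Rc (gp_map v)].
have compatP : submodule compat.
  by apply: submodule_eq => a v w; rewrite ?gp_rb_linear !linearP ?Rc_linear.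
have compat_gen x :
    gp_map (gp_rb RU (gp_gen p br x)) = Rc (gp_map (gp_gen p br x)).
  by rewrite (gp_rb_gen charkp brL RUP) !gp_map_gen f_R.
move: u; apply: (gp_gen_power_ind charkp brL compatP) => // u uP.
apply: (rb_compat_p_map gpP cP gp_map_power uP).
apply: (submodule_sum compatP) => i _ _.
by have [x _ <-] := gp_jacobson_gen charkp i u (gp_rb RU u).
Qed.

End EnvelopeMap.

Lemma gp_hom_exists : exists h : gpT -> c,
  restricted_rb_hom (@gp_bracket k p g br) (@gp_power k p g br) (gp_rb RU)
    brc pmc Rc h /\ h \o gp_gen p br = f.
Proof.
have [d [I [e e_basis]]] := exists_ordered_basis g.
exists (gp_map e_basis); split; last by apply/funext => x; apply: gp_map_gen.
split; last exact: gp_map_power.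
by split; [exact: linearP | exact: gp_map_bracket | exact: gp_map_rb].
Qed.

Lemma gp_hom_unique (h h' : gpT -> c) :
    restricted_rb_hom (@gp_bracket k p g br) (@gp_power k p g br) (gp_rb RU)
      brc pmc Rc h ->
    restricted_rb_hom (@gp_bracket k p g br) (@gp_power k p g br) (gp_rb RU)
      brc pmc Rc h' ->
  h \o gp_gen p br = h' \o gp_gen p br -> h = h'.
Proof.
move=> [[h_linear _ _] h_pm] [[h'_linear _ _] h'_pm] hh'; apply/funext.
have hh'P : submodule [set u | h u = h' u] by apply: submodule_eq.
apply: (gp_gen_power_ind charkp brL hh'P) => [x|u /= uP].
  exact: (congr1 (fun F => F x) hh').
by rewrite h_pm h'_pm uP.
Qed.

End UniversalProperty.

Theorem gp_universal (k : fieldType) (p : nat) (g : lmodType k)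
    (br : g -> g -> g) (R : g -> g) (RU : uea br -> uea br) :
    p \in [pchar k] -> lie_algebra br -> rb_extension br R RU ->
  universal_rb_p_envelope p 1 br R (@gp_bracket k p g br) (@gp_power k p g br)
    (gp_rb RU) (gp_gen p br).
Proof.
move=> charkp brL RUP; split=> [|c brc pmc Rc cP f fP].
  exact: gp_envelope.
have [h [hP hf]] := gp_hom_exists charkp brL RUP cP fP.
exists h; split=> // h' [h'P h'f].
by apply: (gp_hom_unique charkp brL hP h'P); rewrite hf h'f.
Qed.

Theorem theorem4p22 (k : closedFieldType) (p : nat) (charkp : p \in [pchar k])
    (g : lmodType k) (br : g -> g -> g) (R : g -> g)
    (gRB : rb_lie_algebra 1 br R) :
  gp_set p br = primitives br /\
  exists RU : uea br -> uea br,
    unique (rb_extension br R) RU /\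
    exists (br' : gp p br -> gp p br -> gp p br) (pm' R' : gp p br -> gp p br)
           (i : g -> gp p br),
      [/\ forall u v, gp_val (br' u v) = commutator (gp_val u) (gp_val v),
          forall u, gp_val (pm' u) = gp_val u ^+ p,
          forall u, gp_val (R' u) = RU (gp_val u),
          forall x, gp_val (i x) = uea_gen br x &
          universal_rb_p_envelope p 1 br R br' pm' R' i].
Proof.
have brL := gRB.1; have [RU RUP] := rb_extension_exists gRB.
split; first exact: gp_set_eq_primitives.
exists RU; split; first by split=> // RU'; apply: rb_extension_unique.
exists (@gp_bracket k p g br), (@gp_power k p g br), (gp_rb RU), (gp_gen p br).
split.
- exact: gp_bracketE.
- exact: gp_powerE.
- exact: (gp_rbE charkp brL RUP).
- exact: gp_genE.
- exact: gp_universal.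
Qed.
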